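(* Let $m\ge 1$ and let $Q=[0,1)^m\subset\mathbb{R}^m$ with Lebesgue measure $dx$. Let $f_0$ be a positive measurable function on $Q$ such that $\int_Q f_0\,dx=1$ and $f_0\ge\delta$ almost everywhere for some $\delta>0$. Let $g_0$ be an integrable real function defined on $Q$ such that (a) $\int_Q g_0\,dx=0$, and (b) $\int_Q \frac{g_0^2}{f_0}\,dx=1$. For each $j\ge 0$ let $f_0^j,g_0^j:X_j\to\mathbb{R}$ be the dyadic averages of $f_0$ and $g_0$ on the finite measure space $(X_j,\mu_j)$ (as defined in the context). Set $\alpha_j=\int_{X_j}\frac{(g_0^j)^2}{f_0^j}\,d\mu_j$. Then $\alpha_j>0$ for all sufficiently large $j$, and for such $j$, setting $\widetilde g_0^j=\alpha_j^{-1/2}g_0^j$, one has: (i) $\int_{X_j} f_0^j\,d\mu_j=1$; (ii) $\int_{X_j}\widetilde g_0^j\,d\mu_j=0$; (iii) $\int_{X_j}\frac{(\widetilde g_0^j)^2}{f_0^j}\,d\mu_j=1$; (iv) for $t\in\mathbb{R}$ define on $X_j$ $$f^j(\cdot,t)=\frac{(f_0^j)^2+(\widetilde g_0^j)^2}{f_0^j}\cos^2\Bigl(\frac t2-\tan^{-1}\frac{\widetilde g_0^j}{f_0^j}\Bigr),$$ and for $x\in Q$ define $$f(x,t)=\frac{f_0(x)^2+g_0(x)^2}{f_0(x)}\cos^2\Bigl(\frac t2-\tan^{-1}\frac{g_0(x)}{f_0(x)}\Bigr).$$ Then for every $t\in\mathbb{R}$ and every continuous compactly supported function $\varphi$ on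 $Q$, $$\left|\int_{X_j} f^j(y,t)\varphi(y)\,d\mu_j(y)-\int_Q f(y,t)\varphi(y)\,dy\right|\longrightarrow 0\quad\text{as } j\to\infty.$$
   Context: For an integer $j\ge 0$ let $\mathcal{K}(j)=\{\mathbf{k}=(k_1,\dots,k_m)\in\mathbb{Z}^m: k_i\in\{0,1,\dots,2^j-1\},\ i=1,\dots,m\}$ and, for $\mathbf{k}\in\mathcal{K}(j)$, let $Q^j_{\mathbf{k}}=\prod_{i=1}^m[k_i2^{-j},(k_i+1)2^{-j})$, a dyadic cube of measure $|Q^j_{\mathbf k}|=2^{-mj}$. Let $X_j=\{x_{\mathbf{k}}=\mathbf{k}2^{-j}:\mathbf{k}\in\mathcal{K}(j)\}\subset Q$ and let $\mu_j$ be $2^{-mj}$ times the counting measure on $X_j$. The dyadic averages of $f_0$ and $g_0$ are $$f_0^j(x_{\mathbf{k}})=\frac{1}{|Q^j_{\mathbf{k}}|}\int_{Q^j_{\mathbf{k}}}f_0(y)\,dy,\qquad g_0^j(x_{\mathbf{k}})=\frac{1}{|Q^j_{\mathbf{k}}|}\int_{Q^j_{\mathbf{k}}}g_0(y)\,dy .$$ Here $\tan^{-1}$ is the arctangent with values in $(-\pi/2,\pi/2)$. *)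

(* Defs.v *)
From HB Require Import structures.
From mathcomp Require Import all_boot all_order all_algebra.
From mathcomp Require Import all_classical all_reals all_analysis.
Set Implicit Arguments.
Unset Strict Implicit.
Unset Printing Implicit Defensive.
Import Order.TTheory GRing.Theory Num.Theory.
Import numFieldNormedType.Exports.
Local Open Scope classical_set_scope.
Local Open Scope ring_scope.

(* MathComp-Analysis has no Lebesgue measure on R^m.  It is built here in the
   usual way: outer measure defined by countable covers with half-open boxes,
   then restricted to its Caratheodory-measurable (i.e. Lebesgue-measurable)
   sets.  The dimension is n.+1: in dimension 0 every box has volume 1, and the
   empty set would not get outer measure 0. *)

Section lebesgue_rV.
Context {R : realType} {n : nat}.
Local Notation rV := 'rV[R]_n.+1.
Implicit Types (a b : rV) (A : set rV) (B : nat -> rV * rV).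

Definition box a b : set rV := [set x | forall i, a 0 i <= x 0 i < b 0 i].

(* Num.max accounts for empty boxes. *)
Definition box_vol a b : R := \prod_i Num.max 0 (b 0 i - a 0 i).

Definition box_cover A : set (nat -> rV * rV) :=
  [set B | A `<=` \bigcup_k box (B k).1 (B k).2].

Definition lebesgue_outer A : \bar R :=
  ereal_inf [set (\sum_(k <oo) (box_vol (B k).1 (B k).2)%:E)%E
            | B in box_cover A].

Lemma box_vol_ge0 a b : 0 <= box_vol a b.
Proof. by apply: prodr_ge0 => i _; rewrite le_max lexx. Qed.

Let volE (p : rV * rV) : \bar R := (box_vol p.1 p.2)%:E.

Let volE_ge0 p : (0 <= volE p)%E.
Proof. by rewrite lee_fin box_vol_ge0. Qed.

Lemma box_volxx a : box_vol a a = 0.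
Proof. by rewrite /box_vol big_ord_recl subrr maxxx mul0r. Qed.

Lemma lebesgue_outer_ge0 A : (0 <= lebesgue_outer A)%E.
Proof.
apply: le_ereal_inf_tmp => _ [B _ <-]; apply: nneseries_ge0 => k _ _.
exact: (volE_ge0 (B k)).
Qed.

Lemma lebesgue_outer0 : lebesgue_outer set0 = 0%E.
Proof.
apply/eqP; rewrite eq_le lebesgue_outer_ge0 andbT.
apply: ereal_inf_lbound; exists (fun=> (0, 0)) => //.
by apply: eseries0 => k _ _; rewrite box_volxx.
Qed.

Lemma le_lebesgue_outer :
  {homo lebesgue_outer : A1 A2 / A1 `<=` A2 >-> (A1 <= A2)%E}.
Proof.
move=> A1 A2 A12; apply: ereal_inf_le_tmp => _ [B A2B <-].
by exists B => //; exact: subset_trans A12 A2B.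
Qed.

Lemma lebesgue_outer_sigma_subadditive : sigma_subadditive lebesgue_outer.
Proof.
move=> A; have [[i ioo]|] := pselect (exists i, lebesgue_outer (A i) = +oo%E).
  rewrite (eseries_pinfty _ _ ioo) ?leey// => k _.
  by rewrite -ltNye (lt_le_trans _ (lebesgue_outer_ge0 _)).
rewrite -forallNE => Aoo.
suff add2e (e : {posnum R}) : (lebesgue_outer (\bigcup_k A k) <=
    \sum_(i <oo) lebesgue_outer (A i) + e%:num%:E)%E.
  by apply/lee_addgt0Pr => _/posnumP[].
rewrite (le_trans _ (epsilon_trick _ _ _))//; last first.
  by move=> k; exact: lebesgue_outer_ge0.
pose P k B := box_cover (A k) B /\
  (\sum_(i <oo) volE (B i) <=
     lebesgue_outer (A k) + (e%:num / (2 ^ k.+1)%:R)%:E)%E.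
have [G PG] : {G : nat -> nat -> rV * rV & forall k, P k (G k)}.
  apply: (@choice _ _ P) => k; rewrite /P /lebesgue_outer.
  set S := (X in ereal_inf X); move infS : (ereal_inf S) => iS.
  case: iS infS => [r Sr|Soo|Soo].
  - have en1 : 0 < e%:num / (2 ^ k.+1)%:R by [].
    have /(lb_ereal_inf_adherent en1) : ereal_inf S \is a fin_num by rewrite Sr.
    move=> [x [B AB muBx] xS].
    by exists B; split => //; rewrite [leLHS]muBx -Sr; exact/ltW.
  - by have := Aoo k; rewrite /lebesgue_outer Soo.
  - suff : lbound S 0%E by move/le_ereal_inf_tmp; rewrite Soo.
    by move=> /= _ [B AB <-]; apply: nneseries_ge0 => i _ _; exact: volE_ge0.
pose F := volE \o (fun ij : nat * nat => G ij.1 ij.2).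
have F_ge0 x : (0 <= F x)%E by exact: volE_ge0.
apply: (@le_trans _ _ (\esum_(i in [set: nat * nat]) F i)%E).
  apply: ereal_inf_lbound => /=.
  have /card_esym/ppcard_eqP[f] := card_nat2.
  exists (fun k => G (f k).1 (f k).2).
    move=> t [i _ /(PG i).1 [j _ Bijt]]; exists (f^-1%FUN (i, j)) => //=.
    by rewrite invK ?inE.
  rewrite (reindex_esum [set: nat] [set: nat * nat] f)//.
  by rewrite nneseries_esumT// => k; exact: (volE_ge0 (G _ _)).
have -> : (\esum_(i in [set: nat * nat]) F i =
    \sum_(i <oo) \sum_(j <oo) volE (G i j))%E.
  rewrite nneseries_esumT; last first.
    by move=> k; apply: nneseries_ge0 => j _ _; exact: volE_ge0.
  under [RHS]eq_esum => i _.
    rewrite nneseries_esumT; last by move=> j; exact: volE_ge0.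
    over.
  rewrite esum_esum//=.
  by congr (esum _ _); apply/seteqP; split => -[].
apply: lee_nneseries => [k _ _|k _]; last exact: (PG k).2.
by apply: nneseries_ge0 => j _ _; exact: volE_ge0.
Qed.

HB.instance Definition _ := isOuterMeasure.Build R rV lebesgue_outer
  lebesgue_outer0 lebesgue_outer_ge0 le_lebesgue_outer
  lebesgue_outer_sigma_subadditive.

Definition lebesgue_rV : set (caratheodory_type lebesgue_outer) -> \bar R :=
  lebesgue_outer.

HB.instance Definition _ := isMeasure.Build _ _ _ lebesgue_rV
  (@caratheodory_measure0 _ _ lebesgue_outer)
  (@caratheodory_measure_ge0 _ _ lebesgue_outer)
  (@caratheodory_measure_sigma_additive _ _ lebesgue_outer).

End lebesgue_rV.

Section dyadic.
Context {R : realType} {n : nat}.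
Local Notation rV := 'rV[R]_n.+1.
Local Notation leb := (@lebesgue_rV R n).
Implicit Types (f g phi : rV -> R) (x : rV) (t : R) (j : nat).

Definition unit_cube : set rV := box 0 (const_mx 1).

Definition dyadic_point j (k : {ffun 'I_n.+1 -> 'I_(2 ^ j)}) : rV :=
  \row_i ((k i)%:R / 2 ^+ j).

Definition dyadic_grid j : set rV := range (@dyadic_point j).

(* A dyadic cube of side 2^-j is indexed by its lower corner
   x_k = k 2^-j instead of k. *)
Definition dyadic_cube j x : set rV := box x (x + const_mx (2 ^- j)).

(* 2^(-mj) times the counting measure, every set being measurable; it is only
   integrated against over [dyadic_grid j]. *)
Definition dyadic_measure j :
    set (g_sigma_algebraType [set: set rV]) -> \bar R :=
  mscale (2^-1 ^+ (n.+1 * j))%:nng counting.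

HB.instance Definition _ j := Measure.on (dyadic_measure j).

Definition dyadic_average j f x : R :=
  (fine (leb (dyadic_cube j x)))^-1 * \int[leb]_(y in dyadic_cube j x) f y.

Definition dyadic_energy j f g : R :=
  \int[dyadic_measure j]_(x in dyadic_grid j)
    (dyadic_average j g x ^+ 2 / dyadic_average j f x).

Definition dyadic_normalized j f g x : R :=
  (Num.sqrt (dyadic_energy j f g))^-1 * dyadic_average j g x.

Definition density_curve f g t x : R :=
  (f x ^+ 2 + g x ^+ 2) / f x * cos (t / 2 - atan (g x / f x)) ^+ 2.

(* The support is relative to the half-open cube: a compact subset of the cube
   may touch its lower faces, but not the upper ones. *)
Definition compactly_supported_in_cube phi : Prop :=
  compact (unit_cube `&` closure (unit_cube `&` [set x | phi x != 0])).

End dyadic.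

(* Main.v *)
Require Import Defs.
From mathcomp Require Import all_boot all_order all_algebra.
From mathcomp Require Import all_classical all_reals all_analysis.
From mathcomp Require Import measurable_realfun ring lra.
Import Order.TTheory GRing.Theory Num.Theory.
Import numFieldNormedType.Exports.
Local Open Scope classical_set_scope.
Local Open Scope ring_scope.

Set Implicit Arguments.
Unset Strict Implicit.
Unset Printing Implicit Defensive.

(** The curve of densities is polynomial in disguise: cos (atan u)^2 is
    1 / (1 + u^2), so with u = g / f the density at time t is
      f (c + s u)^2 = c^2 f + 2 c s g + s^2 g^2 / f,
    where c = cos (t/2) and s = sin (t/2) ([density_curveE]).  Everything is
    thus reduced to the weak convergence of the dyadic averages of f and g,
    and of the quotients (g^j)^2 / f^j.

    Write y |-> y_j for the map sending a point to the lower corner of its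
    dyadic cube ([dyadic_floor]).  Summing over the cubes, the grid mean of
    h F^j is the integral of h(y_j) F(y) over the cube
    ([Rintegral_dyadic_step]).  With h = 1 this gives the conservation of the
    mean of f and g; with h = phi it gives, by dominated convergence, the weak
    convergence of F^j to F for every integrable F ([cvg_grid_mean]).

    The quadratic term is handled in L^2(f dy).  There u_j = g^j / f^j is the
    orthogonal projection of u = g / f on the functions that are constant on
    the cubes of level j, and the energy alpha_j is the squared norm of u_j.
    Hence 1 - alpha_j is the squared distance from u to these functions
    ([ratio_sqdist_avg], [ratio_sqdist_avg_le]); it tends to 0 because dyadic
    step functions are dense ([dyadic_approximable_L2]).  So alpha_j tends to 1,
    and the norm convergence of u_j to u lets one replace u_j^2 by u^2 in the
    integral of phi(y_j) u_j(y_j)^2 f(y) ([grid_energy_dist],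
    [cvg_grid_energy]).

    Density itself follows from the construction of the measure.  A measurable
    set is, up to small measure, a finite union of half-open boxes, and the
    indicator of such a box at the upper corner of the dyadic cube of y is
    eventually equal to the indicator at y, for every y ([near_box_shift]).
    Simple functions and monotone approximation then reach all of L^2.

    One fact about Lebesgue measure has to be established on the way: a box
    has outer measure equal to its volume.  Covers cannot be cheaper
    ([prod_length_subadditive]), by induction on the dimension: slice along
    the last coordinate, apply the induction hypothesis to every slice, and
    integrate over that coordinate. *)

(** * Lebesgue measure of boxes *)
Section box_volume.
Context {R : realType}.

Let len (a b : R) : R := Num.max 0 (b - a).

Let len_ge0 a b : 0 <= len a b.
Proof. by rewrite le_max lexx. Qed.

Let lebesgue_len (a b : R) :
  (@lebesgue_measure R `[a, b[%classic = (len a b)%:E)%E.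
Proof.
rewrite lebesgue_measure_itv/= lte_fin /len; case: ltP => ab.
  by rewrite -EFinB max_r// subr_ge0 ltW.
by rewrite max_l// subr_le0.
Qed.

Lemma term_le_nneseries (u : nat -> \bar R) k :
  (forall i, 0 <= u i)%E -> (u k <= \sum_(i <oo) u i)%E.
Proof.
move=> u0; apply: (@le_trans _ _ (\sum_(0 <= i < k.+1) u i)%E).
  by rewrite big_nat_recr//= leeDr// sume_ge0.
exact: nneseries_lim_ge.
Qed.

(** Coordinates are indexed by [nat] so that the last one can be peeled off
    without casts between ordinal types.  The slice of the cover above [x] is
    the subfamily of boxes whose last side contains [x]; integrating the
    inequality for slices over [x] restores the last side of every box. *)
Lemma prod_length_subadditive (m : nat) (a b : nat -> R)
    (A B : nat -> nat -> R) :
  (forall x : nat -> R, (forall i, (i < m)%N -> a i <= x i < b i) ->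
     exists k, forall i, (i < m)%N -> A k i <= x i < B k i) ->
  ((\prod_(i < m) len (a i) (b i))%:E <=
     \sum_(k <oo) (\prod_(i < m) len (A k i) (B k i))%:E)%E.
Proof.
have pge0 m' (c d : nat -> R) : 0 <= \prod_(i < m') len (c i) (d i).
  by apply: prodr_ge0 => i _.
elim: m a b A B => [|m IH] a b A B cov.
  have [k _] := cov (fun=> 0) ltac:(by []).
  by rewrite big_ord0; under eq_eseriesr do rewrite big_ord0;
    exact: (@term_le_nneseries (fun=> 1%E) k (fun=> lee01)).
pose F k (x : R) : \bar R :=
  ((\prod_(i < m) len (A k i) (B k i)) *
   \1_(`[A k m, B k m[%classic : set R) x)%:E.
have F0 k x : (0 <= F k x)%E.
  by rewrite lee_fin mulr_ge0.
have mF k : measurable_fun (`[a m, b m[%classic : set R) (F k).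
  apply/measurable_EFinP; apply: measurable_funM => //.
have slice (x : R) : a m <= x < b m ->
    ((\prod_(i < m) len (a i) (b i))%:E <= \sum_(k <oo) F k x)%E.
  move=> xab.
  pose A' k i := A k i.
  pose B' k i := if x \in (`[A k m, B k m[%classic : set R) then B k i else A k i.
  (* The boxes missing [x] are emptied by collapsing one of their sides, which
     takes at least one remaining coordinate. *)
  case: m => [|m'] in IH cov F F0 mF xab A' B' *.
    have [k /(_ 0%N isT)] := cov (fun=> x) ltac:(by case).
    move=> xk.
    apply: (le_trans _ (@term_le_nneseries (F ^~ x) k (F0 ^~ x))).
    by rewrite /F !big_ord0 mul1r indicE mem_set//= in_itv.
  apply: (@le_trans _ _
      (\sum_(k <oo) (\prod_(i < m'.+1) len (A' k i) (B' k i))%:E)%E).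
    apply: IH => z zab.
    have [|k zk] := cov (fun i => if i == m'.+1 then x else z i).
      move=> i; rewrite ltnS leq_eqVlt => /predU1P[->|im]; first by rewrite eqxx.
      by rewrite ltn_eqF//; exact: zab.
    exists k => i im; rewrite /A' /B'.
    have := zk m'.+1 (ltnSn _); rewrite eqxx => xk.
    rewrite mem_set/=; last by rewrite in_itv.
    by have := zk i (ltnW im); rewrite ltn_eqF.
  apply: lee_nneseries => [k _ _|k _]; first by rewrite lee_fin.
  rewrite /F lee_fin indicE /B' /A'.
  case: (x \in _); first by rewrite mulr1.
  by rewrite mulr0 big_ord_recl /len subrr maxxx mul0r.
rewrite big_ord_recr/= EFinM -lebesgue_len -integral_cst//=.
apply: (@le_trans _ _
    (\int[lebesgue_measure]_(x in `[a m, b m[) \sum_(k <oo) F k x)%E).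
  apply: ge0_le_integral => //=.
  - by move=> x _; rewrite lee_fin; exact: pge0.
  - by apply: (@ge0_emeasurable_sum _ _ _ _ F xpredT) => // k x _ _; exact: F0.
rewrite integral_nneseries//.
apply: lee_nneseries => [k _ _|k _]; first exact: integral_ge0.
rewrite big_ord_recr/= EFinM /F.
under eq_integral do rewrite EFinM.
rewrite ge0_integralZl//; last 2 first.
  by apply/measurable_EFinP.
  by rewrite lee_fin.
rewrite lee_wpmul2l ?lee_fin// integral_indic//= -lebesgue_len.
by apply: le_measure; rewrite ?inE//; apply: measurableI.
Qed.

End box_volume.

Section lebesgue_box.
Context {R : realType} {n : nat}.
Local Notation rV := 'rV[R]_n.+1.
Local Notation lrV := (caratheodory_type (@lebesgue_outer R n)).
Local Notation mu := (@lebesgue_rV R n).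
Implicit Types (a b c x : rV).

Lemma lebesgue_outer_le_cover (A : set rV) B : box_cover A B ->
  (lebesgue_outer A <= \sum_(k <oo) (box_vol (B k).1 (B k).2)%:E)%E.
Proof. by move=> AB; apply: ereal_inf_lbound; exists B. Qed.

Lemma lebesgue_outer_box a b : lebesgue_outer (box a b) = (box_vol a b)%:E.
Proof.
apply/eqP; rewrite eq_le; apply/andP; split.
  pose B k : rV * rV := if k is 0%N then (a, b) else (0, 0).
  apply: le_trans (@lebesgue_outer_le_cover _ B _) _.
    by move=> x abx; exists 0%N.
  rewrite nneseries_recl//; last by move=> k _; rewrite lee_fin box_vol_ge0.
  by rewrite eseries0 ?adde0// => -[|k] //= _ _; rewrite box_volxx.
apply: le_ereal_inf_tmp => _ [B abB <-].
pose nth_entry c i := c 0 (inord i).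
have volE c d : box_vol c d =
    \prod_(i < n.+1) Num.max 0 (nth_entry d i - nth_entry c i).
  by apply: eq_bigr => i _; rewrite /nth_entry inord_val.
rewrite volE; under eq_eseriesr do rewrite volE.
apply: (@prod_length_subadditive R n.+1 (nth_entry a) (nth_entry b)
  (fun k => nth_entry (B k).1) (fun k => nth_entry (B k).2)) => x xab.
have [|k _ Bkx] := abB (\row_i x i).
  by move=> i; have := xab i (ltn_ord i); rewrite /nth_entry mxE inord_val.
by exists k => i im; have := Bkx (inord i); rewrite mxE inordK.
Qed.

Lemma box_vol_split a b (i : 'I_n.+1) (t : R) :
  box_vol a b =
    box_vol a (\row_k if k == i then Num.min (b 0 k) t else b 0 k) +
    box_vol (\row_k if k == i then Num.max (a 0 k) t else a 0 k) b.
Proof.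
rewrite /box_vol [LHS](bigD1 i)//= [X in _ = X + _](bigD1 i)//=.
rewrite [X in _ = _ + X](bigD1 i)//= !mxE eqxx.
rewrite [X in _ = _ * X + _](eq_bigr (fun k => Num.max 0 (b 0 k - a 0 k))).
  rewrite [X in _ = _ + _ * X](eq_bigr (fun k => Num.max 0 (b 0 k - a 0 k))).
    rewrite -mulrDl; congr (_ * _).
    move: (a 0 i) (b 0 i) => x y; rewrite !maxEle minEle.
    by case: (leP y t) => ?; case: (leP x t) => ?;
      repeat (match goal with |- context [if ?c <= ?d then _ else _] =>
        case: (leP c d) => ? end); lra.
  by move=> k ki; rewrite mxE (negbTE ki).
by move=> k ki; rewrite mxE (negbTE ki).
Qed.

(** Carathéodory's criterion for a half-space: it cuts each box of a cover into
    two boxes whose volumes add up ([box_vol_split]). *)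
Lemma measurable_halfspace (i : 'I_n.+1) (t : R) :
  measurable ([set x : rV | x 0 i < t] : set lrV).
Proof.
apply: le_caratheodory_measurable => X; set H := [set x | _].
apply: le_ereal_inf_tmp => _ [B XB <-].
under eq_eseriesr do rewrite (box_vol_split _ _ i t) EFinD.
rewrite nneseriesD; try by move=> k _ _; rewrite lee_fin box_vol_ge0.
apply: leeD.
  pose C k := ((B k).1, \row_l if l == i then Num.min ((B k).2 0 l) t
                               else (B k).2 0 l).
  apply: (@lebesgue_outer_le_cover _ C) => x [/XB[k _ Bx] xt].
  exists k => // l; have := Bx l; rewrite mxE; case: eqP => // -> /andP[-> /= xB].
  by rewrite lt_min xB.
pose C k := (\row_l (if l == i then Num.max ((B k).1 0 l) t
                    else (B k).1 0 l), (B k).2).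
apply: (@lebesgue_outer_le_cover _ C) => x [/XB[k _ Bx] /= xt].
exists k => // l; have := Bx l; rewrite mxE; case: eqP => // -> /andP[xB ->] /=.
by rewrite ge_max xB andbT leNgt; apply/negP.
Qed.

Lemma measurable_box a b : measurable (box a b : set lrV).
Proof.
have -> : box a b = \bigcap_(i in [set: 'I_n.+1])
    ([set x : rV | x 0 i < b 0 i] `\` [set x : rV | x 0 i < a 0 i]).
  apply/seteqP; split=> x /= abx i.
    move=> _; have /andP[aix xib] := abx i; split => //=.
    by apply/negP; rewrite -leNgt.
  by have [/= xib /negP] := abx i I; rewrite -leNgt => aix; apply/andP.
apply: fin_bigcap_measurable => // i _.
by apply: measurableD; exact: measurable_halfspace.
Qed.

Lemma lebesgue_box a b : mu (box a b) = (box_vol a b)%:E.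
Proof. exact: lebesgue_outer_box. Qed.

End lebesgue_box.

(** * Dyadic cubes and grid means *)

Section finite_partition.
Context d {T : measurableType d} {R : realType}.
Variable m : {measure set T -> \bar R}.

Lemma integral_finite_partition (I : finType) (F : I -> set T) (D : set T)
    (f : T -> R) :
  (forall i, measurable (F i)) ->
  (forall i k, F i `&` F k !=set0 -> i = k) ->
  D = \bigcup_i F i ->
  measurable_fun D f ->
  (\int[m]_(x in D) (f x)%:E = \sum_i \int[m]_(x in F i) (f x)%:E)%E.
Proof.
move=> mF tF DF mf.
have DE : D = \big[setU/set0]_(i <- index_enum I) F i.
  rewrite DF -bigcup_seq; congr bigcup.
  by apply/seteqP; split => i //= _; rewrite mem_index_enum.
rewrite {1}DE integral_bigsetU_EFin ?index_enum_uniq//; last first.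
  by rewrite -DE; exact/measurable_EFinP.
by move=> i k _ _; exact: tF.
Qed.

End finite_partition.

Section dyadic_step.
Context {R : realType} {n : nat}.
Local Notation rV := 'rV[R]_n.+1.
Local Notation lrV := (caratheodory_type (@lebesgue_outer R n)).
Local Notation mu := (@lebesgue_rV R n).
Local Notation Q := (@unit_cube R n).
Implicit Types (x y : rV) (h F phi : rV -> R) (j : nat).

(** The lower corner of the dyadic cube of level [j] containing [y]. *)
Definition dyadic_floor j y : rV :=
  \row_i ((Num.floor (2 ^+ j * y 0 i))%:~R / 2 ^+ j).

Let pow2_gt0 j : 0 < 2 ^+ j :> R.
Proof. exact: exprn_gt0. Qed.

Lemma dyadic_floor_bounds j y i :
  dyadic_floor j y 0 i <= y 0 i < dyadic_floor j y 0 i + 2 ^- j.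
Proof.
have /andP[fl flS] := floor_itv (2 ^+ j * y 0 i).
rewrite mxE ler_pdivrMr// [y 0 i * _]mulrC fl/=.
by rewrite -[X in _ + X]mul1r -mulrDl ltr_pdivlMr// [y 0 i * _]mulrC -intrD1.
Qed.

Lemma dyadic_cubeE j (k : {ffun 'I_n.+1 -> 'I_(2 ^ j)}) y :
  dyadic_cube j (dyadic_point k) y <-> dyadic_floor j y = dyadic_point k.
Proof.
rewrite /dyadic_cube /box; split => [yk|<- i]; last first.
  by rewrite !mxE; have := dyadic_floor_bounds j y i; rewrite !mxE.
apply/rowP => i; rewrite !mxE; congr (_ / _).
have := yk i; rewrite !mxE -[X in _ + X]mul1r -mulrDl.
rewrite ler_pdivrMr// ltr_pdivlMr// [y 0 i * _]mulrC => yi.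
rewrite (@floor_def _ _ (k i)%:Z) ?pmulrn//.
by rewrite intrD1 -!pmulrn.
Qed.

Lemma dyadic_floor_grid j y : Q y ->
  exists k, dyadic_floor j y = @dyadic_point R n j k.
Proof.
move=> Qy.
have fl_ge0 i : 0 <= Num.floor (2 ^+ j * y 0 i).
  by rewrite floor_ge0 pmulr_rge0//; have := Qy i; rewrite !mxE => /andP[].
have fl_lt (i : 'I_n.+1) : (`|Num.floor ((2 ^+ j * y 0%R i)%R)| < 2 ^ j)%N.
  rewrite -ltz_nat gez0_abs// floor_lt_int -pmulrn natrX gtr_pMr//.
  by have := Qy i; rewrite !mxE => /andP[].
exists [ffun i => Ordinal (fl_lt i)]; apply/rowP => i; rewrite !mxE ffunE/=.
by rewrite [X in _ = X / _]pmulrn gez0_abs.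
Qed.

Lemma dyadic_point_inj j : injective (@dyadic_point R n j).
Proof.
move=> k l /rowP kl; apply/ffunP => i; have := kl i; rewrite !mxE => /mulIf.
have h0 : (2 ^+ j)^-1 != 0 :> R by rewrite invr_eq0 gt_eqF.
by move=> /(_ h0)/eqP; rewrite eqr_nat => /eqP/val_inj.
Qed.

Lemma dyadic_cube_disjoint j (k l : {ffun 'I_n.+1 -> 'I_(2 ^ j)}) :
  dyadic_cube j (dyadic_point k) `&` dyadic_cube j (dyadic_point l : rV)
    !=set0 -> k = l.
Proof.
by move=> [y [/dyadic_cubeE yk /dyadic_cubeE]]; rewrite yk => /dyadic_point_inj.
Qed.

Lemma unit_cube_dyadic j :
  Q = \bigcup_k dyadic_cube j (@dyadic_point R n j k).
Proof.
apply/seteqP; split => y.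
  by move=> /(dyadic_floor_grid j)[k yk]; exists k => //; exact/dyadic_cubeE.
move=> [k _ yk] i; have := yk i; rewrite !mxE => /andP[ky yk1].
rewrite (le_trans _ ky) ?divr_ge0// ?ltW//=.
rewrite (lt_le_trans yk1)// -[X in _ + X]mul1r -mulrDl ler_pdivrMr// mul1r.
by rewrite natr1 -natrX ler_nat.
Qed.

Lemma measurable_dyadic_cube j x : measurable (dyadic_cube j x : set lrV).
Proof. exact: measurable_box. Qed.

Lemma measurable_unit_cube : measurable (Q : set lrV).
Proof. exact: measurable_box. Qed.

Lemma lebesgue_dyadic_cube j x :
  mu (dyadic_cube j x) = (2^-1 ^+ (n.+1 * j))%:E.
Proof.
rewrite lebesgue_box /box_vol; congr EFin.
under eq_bigr do rewrite !mxE addrAC subrr add0r max_r ?invr_ge0 ?ltW//.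
by rewrite prodr_const card_ord -exprVn -exprM mulnC.
Qed.

Lemma lebesgue_unit_cube : mu Q = 1%E.
Proof.
rewrite lebesgue_box /box_vol; congr EFin.
by apply: big1 => i _; rewrite !mxE subr0 max_r.
Qed.

(** The real value of the integral over the grid for [dyadic_measure j]. *)
Definition grid_mean j h : R :=
  2^-1 ^+ (n.+1 * j) * \sum_k h (@dyadic_point R n j k).

Lemma integral_dyadic_grid j h :
  (\int[@dyadic_measure R n j]_(x in dyadic_grid j) (h x)%:E
     = (grid_mean j h)%:E)%E.
Proof.
have mall (A : set (g_sigma_algebraType [set: set rV])) : measurable A.
  exact: sub_sigma_algebra.
rewrite (@integral_finite_partition _ _ _ _ _
  (fun k => [set @dyadic_point R n j k]
    : set (g_sigma_algebraType [set: set rV])))//; last 2 first.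
- by move=> k l [_ [/= ->]] /dyadic_point_inj.
- by rewrite /dyadic_grid; apply/seteqP; split => [_ [k _ <-]|_ [k _ ->]];
    exists k.
rewrite /grid_mean mulr_sumr -sumEFin; apply: eq_bigr => k _.
rewrite (@eq_integral _ _ _ _ _ (cst (h (dyadic_point k))%:E)); last first.
  by move=> x; rewrite inE => ->.
rewrite integral_cst// mulrC EFinM; congr (_ * _)%E.
rewrite /= /dyadic_measure /mscale /= /counting asboolT//.
by rewrite fset_set1 finmap.cardfs1 mule1.
Qed.

Lemma Rintegral_dyadic_grid j h :
  \int[@dyadic_measure R n j]_(x in dyadic_grid j) h x = grid_mean j h.
Proof. by rewrite /Rintegral integral_dyadic_grid. Qed.

Lemma grid_meanD j h k :
  grid_mean j (fun x => h x + k x) = grid_mean j h + grid_mean j k.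
Proof. by rewrite /grid_mean big_split mulrDr. Qed.

Lemma grid_meanZ j (r : R) h : grid_mean j (fun x => r * h x) = r * grid_mean j h.
Proof. by rewrite /grid_mean -mulr_sumr mulrCA. Qed.

Lemma dyadic_step_bounded j h :
  exists M, forall y, Q y -> `|h (dyadic_floor j y)| <= M.
Proof.
exists (\sum_k `|h (@dyadic_point R n j k)|) => y /(dyadic_floor_grid j)[k ->].
by rewrite (bigD1 k)//= lerDl sumr_ge0.
Qed.

Lemma measurable_dyadic_step j h :
  measurable_fun (Q : set lrV) (fun y => h (dyadic_floor j y)).
Proof.
apply: (@eq_measurable_fun _ _ _ _ _ (fun y : lrV => \sum_(k <- index_enum _)
    h (dyadic_point k) * \1_(dyadic_cube j (@dyadic_point R n j k) : set lrV) y)).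
  move=> y; rewrite inE => /(dyadic_floor_grid j)[k yk].
  rewrite (bigD1 k)//= big1 ?addr0 => [|l /negP lk].
    by rewrite indicE mem_set ?mulr1 ?yk//; apply/dyadic_cubeE.
  rewrite indicE memNset ?mulr0// => /dyadic_cubeE.
  by rewrite yk => /dyadic_point_inj kl; apply: lk; apply/eqP.
apply: measurable_sum => k; apply: measurable_funM => //.
by apply: measurable_indic; exact: measurable_dyadic_cube.
Qed.

(** The two factors 2^(-mj), one in the measure of the grid and one in the
    normalization of the average, cancel on each cube. *)
Lemma Rintegral_dyadic_step j h F : mu.-integrable Q (EFin \o F) ->
  \int[mu]_(y in Q) (h (dyadic_floor j y) * F y) =
  grid_mean j (fun x => h x * dyadic_average j F x).
Proof.
move=> iF.
have iFk k : mu.-integrable (dyadic_cube j (@dyadic_point R n j k)) (EFin \o F).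
  apply: integrableS iF => //; [exact: measurable_unit_cube|
    exact: measurable_dyadic_cube|].
  by move=> y yk; rewrite (unit_cube_dyadic j); exists k.
rewrite /Rintegral (@integral_finite_partition _ _ _ _ _
  (fun k => dyadic_cube j (@dyadic_point R n j k) : set lrV)); first last.
- apply: measurable_funM; first exact: measurable_dyadic_step.
  by apply/measurable_EFinP; exact: measurable_int iF.
- exact: unit_cube_dyadic.
- exact: dyadic_cube_disjoint.
- by move=> k; exact: measurable_dyadic_cube.
rewrite /grid_mean mulr_sumr.
transitivity (fine (\sum_k (h (dyadic_point k) *
    \int[mu]_(y in dyadic_cube j (@dyadic_point R n j k)) F y)%:E)).
  congr fine; apply: eq_bigr => k _.
  rewrite EFinM fineK; last first.
    by apply: integrable_fin_num => //; exact: measurable_dyadic_cube.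
  rewrite -integralZl//; last exact: measurable_dyadic_cube.
  by apply: eq_integral => y; rewrite inE => /dyadic_cubeE ->; rewrite EFinM.
rewrite sumEFin/=; apply: eq_bigr => k _.
by rewrite /dyadic_average lebesgue_dyadic_cube/= mulrCA mulVKf.
Qed.

End dyadic_step.

(** * Weak convergence of dyadic averages *)

Section real_dominated_convergence.
Context d {T : measurableType d} {R : realType}.
Variable m : {measure set T -> \bar R}.

Lemma Rintegral_dominated_cvg (D : set T) (f_ : nat -> T -> R) (f g : T -> R) :
  measurable D -> (forall j, measurable_fun D (f_ j)) ->
  (forall x, D x -> f_ ^~ x @ \oo --> f x) ->
  m.-integrable D (EFin \o g) ->
  (forall j x, D x -> `|f_ j x| <= g x) ->
  m.-integrable D (EFin \o f) /\
  \int[m]_(x in D) f_ j x @[j --> \oo] --> \int[m]_(x in D) f x.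
Proof.
move=> mD mf_ cf ig fg.
have mf : measurable_fun D f by apply: (measurable_fun_cvg mf_).
have [] := @dominated_convergence _ _ _ m D mD (fun j x => (f_ j x)%:E)
    (EFin \o f) (EFin \o g).
- by move=> j; exact/measurable_EFinP.
- exact/measurable_EFinP.
- by apply: aeW => x Dx; apply: cvg_EFin; [exact: nearW|exact: cf].
- by [].
- by apply: aeW => x j Dx; rewrite lee_fin; exact: fg.
move=> intf _ cvgf; split => //; apply: fine_cvg.
by rewrite fineK// integrable_fin_num.
Qed.

End real_dominated_convergence.

Section dyadic_convergence.
Context {R : realType} {n : nat}.
Local Notation rV := 'rV[R]_n.+1.
Local Notation lrV := (caratheodory_type (@lebesgue_outer R n)).
Local Notation mu := (@lebesgue_rV R n).
Local Notation Q := (@unit_cube R n).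
Implicit Types (x y : rV) (h F phi : rV -> R) (j : nat).

Lemma dyadic_floor_unit_cube j y : Q y -> Q (dyadic_floor j y).
Proof.
move=> Qy i; have /andP[fy _] := dyadic_floor_bounds j y i.
have := Qy i; rewrite !mxE => /andP[y0 y1].
rewrite mxE in fy; rewrite (le_lt_trans fy y1) andbT.
by rewrite divr_ge0// ler0z floor_ge0 mulr_ge0.
Qed.

Lemma cvg_pow2V : (2 ^- j : R) @[j --> \oo] --> 0.
Proof.
under eq_fun do rewrite -exprVn.
by apply: cvg_expr; rewrite ger0_norm ?invr_ge0// invf_lt1// ltr1n.
Qed.

Lemma cvg_dyadic_floor y : dyadic_floor j y @[j --> \oo] --> y.
Proof.
apply/cvgrPdist_lt => e e0; near=> j.
have je : 2 ^- j < e.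
  near: j; have /cvgrPdist_lt/(_ e e0) := cvg_pow2V.
  by apply: filterS => j; rewrite sub0r normrN ger0_norm// invr_ge0 exprn_ge0.
rewrite (le_lt_trans _ je)// [leLHS]mx_normrE.
apply: bigmax_le => [|[a i] _ /=]; first by rewrite invr_ge0 exprn_ge0.
rewrite !mxE; have := dyadic_floor_bounds j y i; rewrite !mxE => /andP[fl flS].
by rewrite ord1 ger0_norm ?subr_ge0// lerBlDl ltW.
Unshelve. all: by end_near. Qed.

Lemma cvg_within_dyadic_floor phi : {within Q, continuous phi} ->
  forall y, Q y -> phi (dyadic_floor j y) @[j --> \oo] --> phi y.
Proof.
move=> /subspace_continuousP cphi y Qy.
apply: cvg_comp (cphi _ Qy) => A /= QA.
have [N _ NA] := @cvg_dyadic_floor y _ QA.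
by exists N => // j /NA; apply; exact: dyadic_floor_unit_cube.
Qed.

(** Off its compact support [phi] vanishes, and on it [phi] is bounded by
    compactness. *)
Lemma compactly_supported_bounded phi : {within Q, continuous phi} ->
  compactly_supported_in_cube phi ->
  exists2 M, 0 <= M & forall y, Q y -> `|phi y| <= M.
Proof.
move=> cphi; rewrite /compactly_supported_in_cube; set K := Q `&` _ => cK.
have /compact_bounded[M [_ PM]] : compact (phi @` K).
  apply: continuous_compact => //.
  by apply: continuous_subspaceW cphi => y [].
exists (`|M| + 1) => [|y Qy]; first by rewrite addr_ge0.
have [->|phi0] := eqVneq (phi y) 0; first by rewrite normr0 addr_ge0.
apply: PM; first by rewrite ltr_pwDr// ler_norm.
by exists y => //; split => //; apply: subset_closure.
Qed.

(** The convergence of the integrals of [phi (dyadic_floor j y) * F y] is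
    dominated by [M * `|F|]. *)
Lemma cvg_grid_mean phi (M : R) F : mu.-integrable Q (EFin \o F) ->
  (forall y, Q y -> phi (dyadic_floor j y) @[j --> \oo] --> phi y) ->
  (forall y, Q y -> `|phi y| <= M) ->
  mu.-integrable Q (EFin \o (fun y => phi y * F y)) /\
  grid_mean j (fun x => phi x * dyadic_average j F x) @[j --> \oo] -->
    \int[mu]_(y in Q) (phi y * F y).
Proof.
move=> iF cphi phiM.
have mF : measurable_fun (Q : set lrV) F.
  by apply/measurable_EFinP; exact: measurable_int iF.
have -> : (fun j => grid_mean j (fun x => phi x * dyadic_average j F x)) =
    (fun j => \int[mu]_(y in Q) (phi (dyadic_floor j y) * F y)).
  by apply/funext => j; rewrite Rintegral_dyadic_step.
apply: (@Rintegral_dominated_cvg _ lrV R mu Q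
  (fun j y => phi (dyadic_floor j y) * F y) (fun y => phi y * F y)
  (fun y => M * `|F y|)).
- exact: measurable_unit_cube.
- by move=> j; apply: measurable_funM => //; exact: measurable_dyadic_step.
- by move=> y Qy; apply: cvgM; [exact: cphi|exact: cvg_cst].
- have : mu.-integrable Q (EFin \o (fun y => `|F y|)).
    exact: (integrable_norm iF).
  by move=> /(@integrableZl _ _ _ _ _ measurable_unit_cube M).
- move=> j y Qy; rewrite normrM ler_wpM2r// phiM//.
  exact: dyadic_floor_unit_cube.
Qed.

End dyadic_convergence.

(** * Approximation in a weighted L2 space *)

(** The step functions of level [j] are kept abstract: all that matters is
    that they are measurable and stable under linear combinations.  The
    section reduces the approximation of square-integrable functions to that
    of indicators. *)
Section weighted_L2_density.
Context d {T : measurableType d} {R : realType}.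
Variables (mu : {measure set T -> \bar R}) (D : set T) (mD : measurable D).
Variable f : T -> R.
Hypothesis f_ge0 : forall y, D y -> 0 <= f y.
Hypothesis f_int : mu.-integrable D (EFin \o f).
Implicit Types (v w h k : T -> R) (e r : R) (j : nat).

Let mf : measurable_fun D f.
Proof. by apply/measurable_EFinP; exact: measurable_int f_int. Qed.

(** Extended-real, so that it makes sense for all measurable [v] and [w],
    square-integrable or not. *)
Definition weighted_sqdist v w : \bar R :=
  (\int[mu]_(y in D) ((v y - w y) ^+ 2 * f y)%:E)%E.

Variable step : nat -> set (T -> R).
Hypothesis measurable_step : forall j h, step j h -> measurable_fun D h.
Hypothesis step0 : forall j, step j (fun=> 0).
Hypothesis stepD : forall j h k, step j h -> step j k -> step j (h \+ k).
Hypothesis stepZ : forall j r h, step j h -> step j (fun y => r * h y).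

(** Approximation is required at every sufficiently fine level, not just at
    some level: this is what yields convergence along the whole sequence of
    levels. *)
Definition approximable v : Prop :=
  forall e, 0 < e -> \forall j \near \oo,
    exists2 h, step j h & (weighted_sqdist v h <= e%:E)%E.

Let integrand_ge0 v w y : D y -> (0 <= ((v y - w y) ^+ 2 * f y)%:E)%E.
Proof. by move=> Dy; rewrite lee_fin mulr_ge0 ?sqr_ge0// f_ge0. Qed.

Let integrand_meas v w : measurable_fun D v ->
  measurable_fun D w ->
  measurable_fun D (fun y : T => ((v y - w y) ^+ 2 * f y)%:E).
Proof.
move=> mv mw; apply/measurable_EFinP; apply: measurable_funM => //.
by apply: measurable_funX; exact: measurable_funB.
Qed.

Lemma weighted_sqdistD v v' w w' :
  measurable_fun D v -> measurable_fun D v' ->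
  measurable_fun D w -> measurable_fun D w' ->
  (weighted_sqdist (v \+ v')%R (w \+ w')%R <=
   2%:E * (weighted_sqdist v w + weighted_sqdist v' w'))%E.
Proof.
move=> mv mv' mw mw'; rewrite /weighted_sqdist -ge0_integralD//;
  try exact: integrand_meas; try by move=> y Dy; exact: integrand_ge0.
rewrite -ge0_integralZl//; last 2 first.
- by apply: emeasurable_funD; exact: integrand_meas.
- by move=> y Dy; rewrite adde_ge0// integrand_ge0.
apply: ge0_le_integral => //.
- by move=> y Dy; exact: (integrand_ge0 (v \+ v') (w \+ w')).
- by apply: integrand_meas; exact: measurable_funD.
- apply: measurable_funeM.
  by apply: emeasurable_funD; exact: integrand_meas.
- move=> y Dy; rewrite -EFinD -EFinM lee_fin -mulrDl mulrA ler_wpM2r ?f_ge0//=.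
  (* Parallelogram identity: 2 a^2 + 2 b^2 - (a + b)^2 = (a - b)^2. *)
  rewrite -subr_ge0 (_ : _ - _ = ((v y - w y) - (v' y - w' y)) ^+ 2) ?sqr_ge0//.
  by ring.
Qed.

Lemma approximable_closure v : measurable_fun D v ->
  (forall e, 0 < e -> exists w, [/\ measurable_fun D w,
    approximable w & (weighted_sqdist v w <= e%:E)%E]) ->
  approximable v.
Proof.
move=> mv vw e e0; have e4 : 0 < e / 4 by rewrite divr_gt0.
have [w [mw aw vwe]] := vw _ e4; have := aw _ e4.
apply: filterS => j [h sh wh]; exists h => //.
have mh := measurable_step sh.
have := @weighted_sqdistD (fun y => v y - w y) w (fun=> 0) h.
have -> : (fun y => v y - w y) \+ w = v by apply/funext => y /=; rewrite subrK.
have -> : (fun=> 0) \+ h = h.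
  by apply/funext => y /=; rewrite add0r.
have -> : weighted_sqdist (fun y => v y - w y) (fun=> 0) = weighted_sqdist v w.
  by rewrite /weighted_sqdist; under eq_integral do rewrite subr0.
move=> tri; apply: (le_trans (tri _ _ _ _)) => //; first exact: measurable_funB.
apply: (@le_trans _ _ (2%:E * ((e / 4)%:E + (e / 4)%:E))%E).
  by rewrite lee_wpmul2l// leeD.
by rewrite -EFinD -EFinM lee_fin; lra.
Qed.

Lemma approximableD v w : measurable_fun D v ->
  measurable_fun D w ->
  approximable v -> approximable w -> approximable (v \+ w).
Proof.
move=> mv mw av aw e e0; have e4 : 0 < e / 4 by rewrite divr_gt0.
apply: filterS2 (av _ e4) (aw _ e4) => j [h sh vh] [k sk wk].
exists (h \+ k); first exact: stepD.
have mh := measurable_step sh; have mk := measurable_step sk.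
apply: (le_trans (@weighted_sqdistD v w h
  k _ _ _ _)) => //.
apply: (@le_trans _ _ (2%:E * ((e / 4)%:E + (e / 4)%:E))%E).
  by rewrite lee_wpmul2l// leeD.
by rewrite -EFinD -EFinM lee_fin; lra.
Qed.

Lemma approximableZ r v : measurable_fun D v ->
  approximable v -> approximable (fun y => r * v y).
Proof.
move=> mv av e e0; have r1 : 0 < r ^+ 2 + 1 by rewrite ltr_wpDl ?sqr_ge0.
apply: filterS (av _ (divr_gt0 e0 r1)) => j [h sh vh].
exists (fun x => r * h x); first exact: stepZ.
rewrite /weighted_sqdist (@eq_integral _ _ _ _ _
  (fun y : T => (r ^+ 2)%:E * ((v y - h y) ^+ 2 * f y)%:E)%E).
  rewrite ge0_integralZl//.
  - apply: (@le_trans _ _ ((r ^+ 2)%:E * (e / (r ^+ 2 + 1))%:E)%E).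
      by rewrite lee_wpmul2l// lee_fin sqr_ge0.
    rewrite -EFinM lee_fin mulrCA ger_pMr// ler_pdivrMr// mul1r.
    by rewrite lerDl.
  - by apply: integrand_meas => //; exact: (measurable_step sh).
  - by move=> y Dy; exact: (integrand_ge0 v h).
  - by rewrite lee_fin sqr_ge0.
by move=> y _; rewrite -EFinM; congr EFin => /=; ring.
Qed.

Lemma weighted_sqdist_cvg0 v (w : nat -> T -> R) G :
  measurable_fun D v -> (forall j, measurable_fun D (w j)) ->
  (forall y, D y -> w j y @[j --> \oo] --> v y) ->
  mu.-integrable D (EFin \o G) ->
  (forall j y, D y -> (v y - w j y) ^+ 2 * f y <= G y) ->
  forall e, 0 < e -> \forall j \near \oo, (weighted_sqdist v (w j) <= e%:E)%E.
Proof.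
move=> mv mw wv iG wG e e0.
have [] := @dominated_convergence _ T R mu D mD
    (fun j y => ((v y - w j y) ^+ 2 * f y)%:E) (cst 0%E) (EFin \o G).
- by move=> j; exact: integrand_meas.
- exact: measurable_cst.
- apply: aeW => y Dy; apply: cvg_EFin; first exact: nearW.
  rewrite -[X in _ --> X](_ : (v y - v y) ^+ 2 * f y = 0); last first.
    by rewrite subrr expr0n mul0r.
  apply: cvgM; last exact: cvg_cst.
  rewrite !expr2; apply: cvgM;
    (apply: cvgB; [exact: cvg_cst|exact: wv]).
- by [].
- apply: aeW => y j Dy; rewrite gee0_abs ?lee_fin; first exact: wG.
  exact: integrand_ge0.
move=> _ _; rewrite integral0 => c0.
have e0' : (0 < e%:E)%E by rewrite lte_fin.
have [N _ Ne] := c0 _ (open_ereal_lt' e0').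
by exists N => // j /Ne /ltW.
Qed.

(** The integrand is at most [f] and lives on the symmetric difference, so this
    is the absolute continuity of the integral of [f]. *)
Lemma weighted_sqdist_indic e : 0 < e -> exists2 c : R, 0 < c &
  forall A B, measurable A -> measurable B ->
    (mu (D `&` ((A `\` B) `|` (B `\` A))) < c%:E)%E ->
    (weighted_sqdist \1_A \1_B <= e%:E)%E.
Proof.
move=> e0.
have f0_int : mu.-integrable setT (EFin \o (f \_ D)).
  by rewrite -restrict_EFin; apply/(integrable_mkcond _ mD).
have [c [c0 fc]] := integral_normr_continuous f0_int e0.
exists c => // A B mA mB; set C := D `&` _ => Cc.
have mC : measurable C.
  by apply: measurableI => //; apply: measurableU; exact: measurableD.
have := fc _ mC Cc; rewrite -lte_fin fineK; last first.
  have := integrable_norm f0_int => /(integrableS measurableT mC (@subsetT _ _)).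
  exact: integrable_fin_num.
move=> /ltW; apply: le_trans.
rewrite /weighted_sqdist [leLHS]integral_mkcond [leRHS]integral_mkcond.
apply: ge0_le_integral => //.
- by move=> y _; apply: erestrict_ge0 => {}y Dy; exact: integrand_ge0.
- apply/(measurable_restrictT _ mD); apply: integrand_meas; exact: measurable_indic.
- apply/(measurable_restrictT _ mC)/measurable_EFinP/measurable_funTS.
  apply: measurableT_comp => //.
  by apply/measurable_EFinP; exact: measurable_int f0_int.
- move=> y _; rewrite /patch /=; case: ifPn => [yD|_]; last first.
    by case: ifPn => // _; rewrite lee_fin.
  have Dy : D y by rewrite inE in yD.
  have AB01 : (\1_A y - \1_B y : R) ^+ 2 <= 1.
    rewrite !indicE; case: (_ \in A); case: (_ \in B);
      rewrite ?subrr ?expr0n ?subr0 ?sub0r ?sqrrN ?expr1n//.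
  case: ifPn => [_|/negP yC].
    by rewrite lee_fin (ger0_norm (f_ge0 Dy)) ler_piMl ?f_ge0.
  have AB : (y \in A) = (y \in B).
    apply/idP/idP; rewrite !inE => yA; apply: contrapT => nyA; apply: yC;
      rewrite inE; split => //; first by left.
    by right.
  by rewrite !indicE AB subrr expr0n mul0r.
Qed.

Hypothesis approximable_indic :
  forall A, measurable A -> approximable \1_A.

Lemma approximable0 : approximable (fun=> 0).
Proof.
move=> e e0; apply: nearW => j; exists (fun=> 0) => //.
rewrite /weighted_sqdist; under eq_integral do rewrite /= subrr expr0n mul0r.
by rewrite integral0 lee_fin ltW.
Qed.

Import HBSimple.

Lemma approximable_sfun (s : {sfun T >-> R}) :
  approximable (s : T -> R).
Proof.
have -> : (s : T -> R) = fun y =>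
    \sum_(r <- finmap.enum_fset (fset_set (range s)))
    r * \1_(s @^-1` [set r]) y.
  by apply/funext => y; rewrite [LHS]fimfunE fsbig_finite.
elim: (finmap.enum_fset _) => [|r t IH].
  have -> : (fun y : T => \sum_(r <- [::]) r * \1_(s @^-1` [set r]) y : R) = fun=> 0.
    by apply/funext => y; rewrite big_nil.
  exact: approximable0.
have ms r' : measurable_fun D (\1_(s @^-1` [set r']) : T -> R).
  by apply: measurable_indic; exact: measurable_sfunP.
have -> : (fun y : T => \sum_(r <- r :: t) r * \1_(s @^-1` [set r]) y : R) =
    (fun y => r * \1_(s @^-1` [set r]) y) \+
    (fun y => \sum_(r <- t) r * \1_(s @^-1` [set r]) y).
  by apply/funext => y; rewrite big_cons.
apply: approximableD => //.
- exact: measurable_funM.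
- by apply: measurable_sum => r'; exact: measurable_funM.
- apply: approximableZ => //.
  by apply: approximable_indic; exact: measurable_sfunP.
Qed.

Import HBNNSimple.

(** The simple functions increasing to [v] satisfy
    [(v - s)^2 f <= v^2 f], which is integrable. *)
Lemma approximable_ge0 v : measurable_fun D v ->
  (forall y, D y -> 0 <= v y) ->
  mu.-integrable D (EFin \o (fun y => v y ^+ 2 * f y)) -> approximable v.
Proof.
move=> mv v0 iv; have mEv : measurable_fun D (EFin \o v).
  exact/measurable_EFinP.
pose s := nnsfun_approx mD mEv.
have Ev0 y : D y -> (0 <= (EFin \o v) y)%E by move=> Dy; rewrite lee_fin v0.
have sv y : D y -> s j y @[j --> \oo] --> v y.
  move=> Dy; have /fine_cvg := cvg_nnsfun_approx mD mEv Ev0 Dy.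
  exact: cvg_trans.
have s_le j y : D y -> s j y <= v y.
  move=> Dy; have svy := sv y Dy.
  rewrite -(cvg_lim _ svy)//; apply: limr_ge; first by apply/cvg_ex; exists (v y).
  exists j => // k /= jk.
  by have /lefP/(_ y) := nd_nnsfun_approx mD mEv jk.
apply: approximable_closure => // e e0.
have sdom j y : D y -> (v y - s j y) ^+ 2 * f y <= v y ^+ 2 * f y.
  move=> Dy; rewrite ler_wpM2r ?f_ge0// lerXn2r ?nnegrE ?v0// ?subr_ge0 ?s_le//.
  by rewrite gerBl.
have ms j : measurable_fun D (s j) by exact: measurable_funTS.
have [N _ Ns] := @weighted_sqdist_cvg0 v (fun j => s j) _ mv ms sv iv sdom e e0.
exists (s N); split; [exact: ms|exact: approximable_sfun|]; exact: (Ns N (leqnn N)).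
Qed.

Lemma approximable_L2 v : measurable_fun D v ->
  mu.-integrable D (EFin \o (fun y => v y ^+ 2 * f y)) -> approximable v.
Proof.
move=> mv iv.
pose p y := Num.max (v y) 0; pose q y := Num.max (- v y) 0.
have mp : measurable_fun D p by exact: measurable_maxr.
have mq : measurable_fun D q.
  by apply: measurable_maxr => //; exact: measurableT_comp.
have part (r : T -> R) : measurable_fun D r ->
    (forall y, 0 <= r y <= `|v y|) -> approximable r.
  move=> mr rv; apply: approximable_ge0 => //.
    by move=> y _; have /andP[] := rv y.
  apply: le_integrable iv => //.
    by apply/measurable_EFinP/measurable_funM => //; exact: measurable_funX.
  move=> y Dy /=; have /andP[r0 rvy] := rv y.
  have sqf z : 0 <= z ^+ 2 * f y by rewrite mulr_ge0 ?sqr_ge0 ?f_ge0.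
  rewrite lee_fin (ger0_norm (sqf (r y))) (ger0_norm (sqf (v y))).
  by rewrite ler_wpM2r ?f_ge0// -(real_normK (num_real (v y))) lerXn2r ?nnegrE.
have -> : v = p \+ (fun y => - 1 * q y).
  apply/funext => y; rewrite /= /p /q; case: (leP 0 (v y)) => v0.
    by rewrite max_r ?mulr0 ?addr0// oppr_le0.
  by rewrite add0r max_l ?mulN1r ?opprK// oppr_ge0 ltW.
apply: approximableD => //.
- exact: measurable_funM.
- by apply: part => // y; rewrite /p le_max lexx orbT/= ge_max ler_norm normr_ge0.
apply: approximableZ => //; apply: part => // y.
by rewrite /q le_max lexx orbT/= ge_max -normrN ler_norm normr_ge0.
Qed.

End weighted_L2_density.

(** * Density of dyadic step functions *)

Section dyadic_density.
Context {R : realType} {n : nat}.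
Local Notation rV := 'rV[R]_n.+1.
Local Notation lrV := (caratheodory_type (@lebesgue_outer R n)).
Local Notation mu := (@lebesgue_rV R n).
Local Notation Q := (@unit_cube R n).
Implicit Types (x y : rV) (u v w h : rV -> R) (j : nat) (e r : R).

Definition dyadic_step j : set (lrV -> R) :=
  [set h | exists k : rV -> R, h = k \o dyadic_floor j].

(** The upper corner z of the dyadic cube of y satisfies y < z coordinatewise
    and tends to y, so it falls on the same side as y of any half-open
    constraint a <= y_i or y_i < b; the lower corner would fail on the faces
    y_i = a. *)
Lemma near_box_shift (a b y : rV) :
  \forall j \near \oo,
    box a b (dyadic_floor j y + const_mx (2 ^- j)) <-> box a b y.
Proof.
pose z j := dyadic_floor j y + const_mx (2 ^- j).
have yz j i : y 0 i < z j 0 i <= y 0 i + 2 ^- j.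
  have /andP[fl flS] := dyadic_floor_bounds j y i.
  by rewrite mxE [const_mx _ _ _]mxE flS lerD2r.
have near_lt i (c : R) : \forall j \near \oo, (z j 0 i < c) = (y 0 i < c).
  have [yc|cy] := ltP (y 0 i) c; last first.
    by near=> j; apply/negbTE; rewrite -leNgt (le_trans cy)// ltW//;
      have /andP[] := yz j i.
  have cy0 : 0 < c - y 0 i by rewrite subr_gt0.
  have /cvgrPdist_lt/(_ _ cy0) := @cvg_pow2V R.
  apply: filterS => j; rewrite sub0r normrN ger0_norm ?invr_ge0 ?exprn_ge0// => jc.
  by have /andP[_ zy] := yz j i; rewrite (le_lt_trans zy)// -ltrBrDl.
have near_all (c : 'I_n.+1 -> R) :
    \forall j \near \oo, forall i, (z j 0 i < c i) = (y 0 i < c i).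
  by apply: filter_forall => i; exact: near_lt.
apply: filterS2 (near_all (a 0)) (near_all (b 0)) => j za zb.
by split=> abz i; have := abz i; rewrite !leNgt za zb.
Unshelve. all: by end_near. Qed.

Lemma box_cover_measure_lt (A : set rV) (e : R) : measurable (A : set lrV) ->
  (mu A < +oo)%E -> 0 < e ->
  exists a b : nat -> rV, A `<=` \bigcup_k box (a k) (b k) /\
    (mu ((\bigcup_k box (a k) (b k)) `\` A) < e%:E)%E.
Proof.
move=> mA Afin e0; have Afn : mu A \is a fin_num by rewrite ge0_fin_numE.
have [_ [B AB <-]] := lb_ereal_inf_adherent e0 Afn.
rewrite -/(lebesgue_outer A) -/(mu A) => Be.
exists (fun k => (B k).1), (fun k => (B k).2); split => //.
set U := \bigcup_k _.
have mU : measurable (U : set lrV).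
  by apply: bigcupT_measurable => k; exact: measurable_box.
have muU : (mu U < mu A + e%:E)%E.
  apply: le_lt_trans Be; apply: lebesgue_outer_le_cover.
  by move=> y [k _ Uk]; exists k.
rewrite measureD//; last first.
  by rewrite (lt_le_trans muU)// leey.
have -> : U `&` A = A by apply/setIidPr.
by rewrite lteBlDl// addeC.
Qed.

Variable f : rV -> R.
Hypothesis f_ge0 : forall y, Q y -> 0 <= f y.
Hypothesis f_int : mu.-integrable Q (EFin \o f).

Let mQ : measurable (Q : set lrV) := measurable_unit_cube.

Let dyadic_measurable j (h : lrV -> R) :
  dyadic_step j h -> measurable_fun (Q : set lrV) h.
Proof. by move=> [k ->]; exact: measurable_dyadic_step. Qed.

(** The upper corner is the lower corner shifted by 2^(-j), so testing it is a
    function of [dyadic_floor j y], that is, a step function. *)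
Lemma dyadic_approximable_boxes (a b : nat -> rV) K :
  approximable mu Q f dyadic_step
    (\1_(\big[setU/set0]_(k < K) box (a k) (b k)) : lrV -> R).
Proof.
set U := \big[setU/set0]_(k < K) _.
have mU : measurable (U : set lrV).
  by apply: bigsetU_measurable => k _; exact: measurable_box.
pose s j : lrV -> R := (fun x => \1_U (x + const_mx (2 ^- j))) \o dyadic_floor j.
have sU y : Q y -> s j y @[j --> \oo] --> (\1_U y : R).
  move=> Qy; apply: cvg_near_cst.
  have : \forall j \near \oo, forall k : 'I_K,
      box (a k) (b k) (dyadic_floor j y + const_mx (2 ^- j)) <->
      box (a k) (b k) y.
    by apply: filter_forall => k; exact: near_box_shift.
  apply: filterS => j jU; rewrite /s /= !indicE; congr (_%:R).
  apply: congr1; apply/idP/idP; rewrite !inE /U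
    -!(bigcup_mkord K (fun k => box (a k) (b k))) => -[k /= kK];
    have := jU (Ordinal kK) => /= -[jl jr] kU; exists k => //; tauto.
have sdom j y : Q y -> ((\1_U y : R) - s j y) ^+ 2 * f y <= f y.
  move=> Qy; rewrite ler_piMl ?f_ge0// /s/= !indicE.
  by case: (_ \in U); case: (_ \in U); rewrite ?subrr ?expr0n ?subr0 ?sub0r
    ?sqrrN ?expr1n.
have ms j : measurable_fun (Q : set lrV) (s j) by exact: measurable_dyadic_step.
have mU1 : measurable_fun (Q : set lrV) (\1_U : lrV -> R).
  exact: measurable_indic.
move=> e e0; have [N _ Ns] := weighted_sqdist_cvg0 mQ f_ge0 f_int
  mU1 ms sU f_int sdom e0.
exists N => // j /Ns sj; exists (s j) => //.
by exists (fun x => \1_U (x + const_mx (2 ^- j))).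
Qed.

(** [A] is replaced by a countable union of boxes that exceeds it little in
    measure, and then by a finite subunion. *)
Lemma dyadic_approximable_indic (A : set lrV) :
  measurable A -> approximable mu Q f dyadic_step (\1_A : lrV -> R).
Proof.
move=> mA; apply: (approximable_closure mQ f_ge0 f_int dyadic_measurable).
  exact: measurable_indic.
move=> e e0.
have [d d0 fd] := weighted_sqdist_indic mQ f_ge0 f_int e0.
have d2 : 0 < d / 2 by rewrite divr_gt0.
have mAQ : measurable (A `&` Q : set lrV) by exact: measurableI.
have AQ1 : (mu (A `&` Q) < +oo)%E.
  apply: (@le_lt_trans _ _ (mu Q)); last by rewrite lebesgue_unit_cube ltry.
  by apply: le_measure; rewrite ?inE//; exact: subIsetr.
have [a [b [AU UA]]] := box_cover_measure_lt mAQ AQ1 d2.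
set U := \bigcup_k _ in AU UA.
pose UK K := \big[setU/set0]_(k < K) box (a k) (b k).
have mU : measurable (U : set lrV).
  by apply: bigcupT_measurable => k; exact: measurable_box.
have mUK K : measurable (UK K : set lrV).
  by apply: bigsetU_measurable => k _; exact: measurable_box.
have UKU K : UK K `<=` U by exact: bigsetU_bigcup.
have Ufin : (mu U < +oo)%E.
  rewrite -(setDUK AU) (le_lt_trans (measureU2 _ _ _))//.
    exact: measurableD.
  by rewrite lte_add_pinfty// (lt_trans UA)// ltry.
have [K UUK] : exists K, (mu (U `\` UK K) < (d / 2)%:E)%E.
  have UE : \bigcup_K UK K = U.
    apply/seteqP; split => y [k _ ky]; first exact: UKU ky.
    by exists k.+1 => //; rewrite /UK big_ord_recr; right.
  have : mu (UK K) @[K --> \oo] --> mu U.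
    rewrite -UE; apply: nondecreasing_cvg_mu => //; first by rewrite UE.
    by move=> k l kl; apply/subsetPset;
      exact: (@subset_bigsetU _ (fun k => box (a k) (b k)) k l kl).
  have Ulow : (mu U - (d / 2)%:E < mu U)%E.
    by rewrite lteBlDr// lteDl ?lte_fin// ge0_fin_numE.
  move=> /(_ _ (open_ereal_gt' Ulow))[K _ /(_ K (leqnn K)) /= UKlow].
  exists K; rewrite measureD//.
  have -> : U `&` UK K = UK K by apply/setIidPr; exact: UKU.
  have UKfin : mu (UK K) \is a fin_num.
    rewrite ge0_fin_numE//; apply: le_lt_trans Ufin.
    by apply: le_measure; rewrite ?inE//; exact: UKU.
  by rewrite lteBlDr// -lteBlDl// ?fin_numB//.
exists (\1_(UK K) : lrV -> R); split;
  [exact: measurable_indic|exact: dyadic_approximable_boxes|].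
apply: fd => //.
have mB : measurable ((U `\` UK K) `|` (U `\` (A `&` Q)) : set lrV).
  by apply: measurableU; exact: measurableD.
apply: (@le_lt_trans _ _ (mu ((U `\` UK K) `|` (U `\` (A `&` Q))))).
  apply: le_measure; rewrite ?inE//.
    apply: measurableI => //; apply: measurableU; exact: measurableD.
  move=> y [Qy [[Ay nUy]|[Uy nAy]]]; first by left; split => //; exact: AU.
  by right; split => [|[]//]; exact: UKU Uy.
rewrite (le_lt_trans (measureU2 _ _ _))//; try exact: measurableD.
by rewrite [d]splitr EFinD lteD.
Qed.

Lemma dyadic_approximable_L2 (v : lrV -> R) : measurable_fun (Q : set lrV) v ->
  mu.-integrable Q (EFin \o (fun y => v y ^+ 2 * f y)) ->
  approximable mu Q f dyadic_step v.
Proof.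
apply: (approximable_L2 mQ f_ge0 f_int dyadic_measurable).
- by move=> j; exists (fun=> 0).
- by move=> j _ _ [h ->] [k ->]; exists (h \+ k).
- by move=> j r _ [h ->]; exists (fun x => r * h x).
- exact: dyadic_approximable_indic.
Qed.

End dyadic_density.

(** * Real-valued integrals *)

Section real_integral.
Context d {T : measurableType d} {R : realType}.
Variables (m : {measure set T -> \bar R}) (D : set T) (mD : measurable D).
Implicit Types (F G : T -> R) (r : R).
Local Notation int F := (\int[m]_(y in D) F y).
Local Notation integrable F := (m.-integrable D (EFin \o F)).

Lemma integrableR_Z r F : integrable F -> integrable (fun y => r * F y).
Proof. exact: (@integrableZl _ _ _ _ _ mD r). Qed.

Lemma integrableR_D F G : integrable F -> integrable G ->
  integrable (fun y => F y + G y).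
Proof. exact: (@integrableD _ _ _ _ _ mD). Qed.

Lemma integrableR_sum3 F1 F2 F3 r1 r2 r3 :
  integrable F1 -> integrable F2 -> integrable F3 ->
  integrable (fun y => r1 * F1 y + r2 * F2 y + r3 * F3 y).
Proof.
move=> i1 i2 i3.
by apply: (integrableR_D (integrableR_D _ _) _); exact: integrableR_Z.
Qed.

Lemma Rintegral_sum3 F1 F2 F3 r1 r2 r3 :
  integrable F1 -> integrable F2 -> integrable F3 ->
  int (fun y => r1 * F1 y + r2 * F2 y + r3 * F3 y) =
  r1 * int F1 + r2 * int F2 + r3 * int F3.
Proof.
move=> i1 i2 i3.
rewrite (@RintegralD _ _ _ _ _ (fun y => r1 * F1 y + r2 * F2 y))//; last 2 first.
- by apply: integrableR_D; exact: integrableR_Z.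
- exact: integrableR_Z.
rewrite (@RintegralD _ _ _ _ _ (fun y => r1 * F1 y))//; try exact: integrableR_Z.
by rewrite !RintegralZl.
Qed.

Lemma integrableR_bounded (h F : T -> R) (M : R) : measurable_fun D h ->
  (forall y, D y -> `|h y| <= M) -> integrable F ->
  integrable (fun y => h y * F y).
Proof.
move=> mh hM iF.
have mF : measurable_fun D F by apply/measurable_EFinP; exact: measurable_int iF.
apply: (le_integrable mD _ _ (@integrableZl _ _ _ _ _ mD M _ (integrable_norm iF))).
  by apply/measurable_EFinP; exact: measurable_funM.
move=> y Dy /=; rewrite lee_fin normrM [leRHS]normrM normr_id ler_wpM2r//.
by rewrite (le_trans (hM _ Dy))// ler_norm.
Qed.

Lemma integrableR_B F G : integrable F -> integrable G ->
  integrable (fun y => F y - G y).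
Proof. exact: (@integrableB _ _ _ _ _ mD). Qed.

Lemma integrableR_ge0 F : measurable_fun D F -> (forall y, D y -> 0 <= F y) ->
  (\int[m]_(y in D) (F y)%:E < +oo)%E -> integrable F.
Proof.
move=> mF F0 Foo; apply/integrableP; split; first exact/measurable_EFinP.
rewrite (@eq_integral _ _ _ _ _ (fun y => (F y)%:E))// => y.
by rewrite inE => Dy; rewrite /= ger0_norm ?F0.
Qed.

Lemma measurable_fun_inv_ge0 F : measurable_fun D F ->
  (forall y, D y -> 0 <= F y) -> measurable_fun D (fun y => (F y)^-1).
Proof.
move=> mF F0; apply: (@eq_measurable_fun _ _ _ _ D (fun y => powR (F y) (-1))).
  by move=> y; rewrite inE => Dy; rewrite powR_inv1 ?F0.
exact: (measurableT_comp (measurable_powR _)).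
Qed.

Lemma measurable_fun_div F G : measurable_fun D F -> measurable_fun D G ->
  (forall y, D y -> 0 <= G y) -> measurable_fun D (fun y => F y / G y).
Proof.
by move=> mF mG G0; apply: measurable_funM => //; exact: measurable_fun_inv_ge0.
Qed.

End real_integral.

(** * Convergence of the dyadic energy *)

(** The ratio [u] stands for g / f and [avg_ratio j] for its projection on the
    step functions of level [j], in L^2(f dy). *)
Section dyadic_energy.
Context {R : realType} {n : nat}.
Local Notation rV := 'rV[R]_n.+1.
Local Notation lrV := (caratheodory_type (@lebesgue_outer R n)).
Local Notation mu := (@lebesgue_rV R n).
Local Notation Q := (@unit_cube R n).
Local Notation int F := (\int[mu]_(y in Q) F y).
Local Notation integrable F := (mu.-integrable Q (EFin \o F)).
Implicit Types (x y : rV) (h phi : rV -> R) (j : nat) (e : R).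

Variables f g : rV -> R.
Hypothesis f_gt0 : forall y, Q y -> 0 < f y.
Hypothesis f_int : integrable f.
Hypothesis g_int : integrable g.
Hypothesis energy_int : integrable (fun y => g y ^+ 2 / f y).
Hypothesis f_avg_gt0 : forall j k, 0 < dyadic_average j f (@dyadic_point R n j k).

Let mQ : measurable (Q : set lrV) := measurable_unit_cube.
Let u y : R := g y / f y.
Let energy := int (fun y => g y ^+ 2 / f y).
Let avg_ratio j x := dyadic_average j g x / dyadic_average j f x.

Lemma dyadic_energyE j : dyadic_energy j f g =
  grid_mean j (fun x => dyadic_average j g x ^+ 2 / dyadic_average j f x).
Proof. exact: Rintegral_dyadic_grid. Qed.

Lemma integrable_dyadic_step j h (F : lrV -> R) : integrable F ->
  integrable (fun y => h (dyadic_floor j y) * F y).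
Proof.
move=> iF; have [M hM] := dyadic_step_bounded j h.
by apply: (integrableR_bounded mQ _ hM iF); exact: measurable_dyadic_step.
Qed.

Lemma eq_grid_mean j h1 h2 :
  (forall k, h1 (@dyadic_point R n j k) = h2 (dyadic_point k)) ->
  grid_mean j h1 = grid_mean j h2.
Proof. by move=> h12; rewrite /grid_mean; under eq_bigr do rewrite h12. Qed.

Lemma le_grid_mean j h1 h2 :
  (forall k, h1 (@dyadic_point R n j k) <= h2 (dyadic_point k)) ->
  grid_mean j h1 <= grid_mean j h2.
Proof.
by move=> h12; rewrite ler_wpM2l ?exprn_ge0 ?invr_ge0// ler_sum.
Qed.

(** Expanding the square gives g^2 / f - 2 h g + h^2 f, whose last two terms
    are products of a step function with [g] and [f]. *)
Lemma ratio_sqdistE j h :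
  integrable (fun y => (u y - h (dyadic_floor j y)) ^+ 2 * f y) /\
  int (fun y => (u y - h (dyadic_floor j y)) ^+ 2 * f y) =
  energy + grid_mean j (fun x => h x ^+ 2 * dyadic_average j f x
                                 - 2 * (h x * dyadic_average j g x)).
Proof.
pose F y := 1 * (g y ^+ 2 / f y) + 1 * (h (dyadic_floor j y) ^+ 2 * f y)
            + (- 2) * (h (dyadic_floor j y) * g y).
have FE y : y \in Q -> (u y - h (dyadic_floor j y)) ^+ 2 * f y = F y.
  rewrite inE => Qy; have f0 : f y != 0 by rewrite gt_eqF// f_gt0.
  by rewrite /F /u; field.
have ihf := integrable_dyadic_step j (fun x => h x ^+ 2) f_int.
have ihg := integrable_dyadic_step j h g_int.
split.
  apply: (eq_integrable mQ (EFin \o F)) => [y yQ|]; first by rewrite /= FE.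
  exact: integrableR_sum3.
rewrite (@eq_Rintegral _ _ _ mu Q F _ FE) Rintegral_sum3// !mul1r.
rewrite (Rintegral_dyadic_step _ (fun x => h x ^+ 2))// Rintegral_dyadic_step//.
rewrite -addrA; congr (_ + _).
by rewrite -grid_meanZ -grid_meanD; apply: eq_grid_mean => k; rewrite mulNr.
Qed.

Lemma ratio_sqdist_avg j :
  int (fun y => (u y - avg_ratio j (dyadic_floor j y)) ^+ 2 * f y) =
  energy - dyadic_energy j f g.
Proof.
rewrite (ratio_sqdistE _ _).2 dyadic_energyE; congr (_ + _).
rewrite -mulN1r -grid_meanZ; apply: eq_grid_mean => k.
have a0 : dyadic_average j f (dyadic_point k) != 0 by rewrite gt_eqF// f_avg_gt0.
by rewrite /avg_ratio; field.
Qed.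

(** Cube by cube, -b^2/a is the minimum over h of h^2 a - 2 h b. *)
Lemma ratio_sqdist_avg_le j h : energy - dyadic_energy j f g <=
  int (fun y => (u y - h (dyadic_floor j y)) ^+ 2 * f y).
Proof.
rewrite (ratio_sqdistE _ _).2 dyadic_energyE lerD2l.
rewrite -mulN1r -grid_meanZ; apply: le_grid_mean => k.
set a := dyadic_average j f _; set b := dyadic_average j g _.
have a0 : 0 < a by exact: f_avg_gt0.
rewrite -subr_ge0 (_ : _ - _ = (b - h (dyadic_point k) * a) ^+ 2 / a).
  by rewrite divr_ge0 ?sqr_ge0// ltW.
by field; rewrite gt_eqF.
Qed.

Lemma dyadic_energy_le j : dyadic_energy j f g <= energy.
Proof.
rewrite -subr_ge0 -ratio_sqdist_avg; apply: Rintegral_ge0 => y Qy.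
by rewrite mulr_ge0 ?sqr_ge0// ltW// f_gt0.
Qed.

(** Pythagoras: the gap is the squared distance from g / f to the step
    functions, which density makes arbitrarily small. *)
Lemma cvg_dyadic_energy : dyadic_energy j f g @[j --> \oo] --> energy.
Proof.
have f_ge0 y : Q y -> 0 <= f y by move=> Qy; rewrite ltW// f_gt0.
have mf : measurable_fun (Q : set lrV) f.
  by apply/measurable_EFinP; exact: measurable_int f_int.
have mg : measurable_fun (Q : set lrV) g.
  by apply/measurable_EFinP; exact: measurable_int g_int.
have m_ratio : measurable_fun (Q : set lrV) u.
  exact: measurable_fun_div mg mf f_ge0.
have iu : integrable (fun y => u y ^+ 2 * f y).
  apply: (eq_integrable mQ _ _ _ energy_int) => y; rewrite inE => Qy /=.
  have f0 : f y != 0 by rewrite gt_eqF// f_gt0.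
  by congr EFin; rewrite /u; field.
apply/cvgrPdist_le => e e0.
have := dyadic_approximable_L2 f_ge0 f_int m_ratio iu e0.
apply: filterS => j [_ [h ->]].
have [ih _] := ratio_sqdistE j h.
rewrite /weighted_sqdist -[leLHS]fineK; last exact: integrable_fin_num.
rewrite lee_fin; apply: le_trans.
by rewrite ger0_norm ?subr_ge0 ?dyadic_energy_le//; exact: ratio_sqdist_avg_le.
Qed.

(** From a^2 - b^2 = - (b - a)^2 - 2 a (b - a) and Young's inequality for the
    cross term.  Integrated, the bound is small when [b - a] is, with [e] as a
    free parameter in front of the bounded term. *)
Lemma young_sqr_dist (a b e : R) : 0 < e ->
  `|a ^+ 2 - b ^+ 2| <= (1 + e^-1) * (b - a) ^+ 2 + e * a ^+ 2.
Proof.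
move=> e0.
have h1 : 2 * a * (b - a) <= e * a ^+ 2 + e^-1 * (b - a) ^+ 2.
  rewrite -subr_ge0 (_ : _ - _ = (e * a - (b - a)) ^+ 2 / e).
    by rewrite divr_ge0 ?sqr_ge0 ?ltW.
  by field; rewrite gt_eqF.
have h2 : - (2 * a * (b - a)) <= e * a ^+ 2 + e^-1 * (b - a) ^+ 2.
  rewrite -subr_ge0 (_ : _ - _ = (e * a + (b - a)) ^+ 2 / e).
    by rewrite divr_ge0 ?sqr_ge0 ?ltW.
  by field; rewrite gt_eqF.
have h3 := sqr_ge0 (b - a).
rewrite ler_norml; apply/andP; split; nra.
Qed.

(** The difference of the two terms is the integral of
    phi(y_j) (u_j(y_j)^2 - u(y)^2) f(y), to which [young_sqr_dist] applies
    pointwise. *)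
Lemma grid_energy_dist j phi (M e : R) : 0 < e ->
  (forall y, Q y -> `|phi y| <= M) ->
  `|grid_mean j (fun x => phi x * (dyadic_average j g x ^+ 2 / dyadic_average j f x))
    - int (fun y => phi (dyadic_floor j y) * (g y ^+ 2 / f y))| <=
  M * ((1 + e^-1) * (energy - dyadic_energy j f g) + e * energy).
Proof.
move=> e0 phiM.
pose v y := avg_ratio j (dyadic_floor j y).
have M0 : 0 <= M.
  apply: le_trans (phiM 0 _); first exact: normr_ge0.
  by move=> i; rewrite !mxE lexx/=.
have favg k : dyadic_average j f (@dyadic_point R n j k) != 0.
  by rewrite gt_eqF// f_avg_gt0.
have -> : grid_mean j (fun x => phi x *
      (dyadic_average j g x ^+ 2 / dyadic_average j f x)) =
    int (fun y => (phi (dyadic_floor j y) * v y ^+ 2) * f y).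
  rewrite (Rintegral_dyadic_step j (fun x => phi x * avg_ratio j x ^+ 2))//.
  apply: eq_grid_mean => k; have := favg k; rewrite /avg_ratio => ?; by field.
have energyE : dyadic_energy j f g = int (fun y => v y ^+ 2 * f y).
  rewrite (Rintegral_dyadic_step j (fun x => avg_ratio j x ^+ 2))// dyadic_energyE.
  apply: eq_grid_mean => k; have := favg k; rewrite /avg_ratio => ?; by field.
have i1 := integrable_dyadic_step j (fun x => phi x * avg_ratio j x ^+ 2) f_int.
have i2 := integrable_dyadic_step j phi energy_int.
have i3 : integrable (fun y => v y ^+ 2 * f y).
  exact: (integrable_dyadic_step j (fun x => avg_ratio j x ^+ 2) f_int).
have [i4 _] := ratio_sqdistE j (avg_ratio j).
rewrite -RintegralB//; apply: (le_trans (le_normr_Rintegral _ _)) => //.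
  exact: (integrableR_B mQ i1 i2).
(* The third term has coefficient 0: it brings the bound to the shape of
   [Rintegral_sum3]. *)
pose bound y := (M * (1 + e^-1)) * ((u y - v y) ^+ 2 * f y)
  + (M * e) * (v y ^+ 2 * f y) + 0 * (v y ^+ 2 * f y).
apply: (@le_trans _ _ (int bound)).
  apply: le_Rintegral => //.
  - exact: (integrable_norm (integrableR_B mQ i1 i2)).
  - exact: integrableR_sum3.
  move=> y Qy; rewrite /bound mul0r addr0.
  have f0 := f_gt0 Qy.
  have -> : phi (dyadic_floor j y) * v y ^+ 2 * f y
      - phi (dyadic_floor j y) * (g y ^+ 2 / f y) =
    phi (dyadic_floor j y) * ((v y ^+ 2 - u y ^+ 2) * f y).
    by rewrite /u; field; rewrite gt_eqF.
  have -> : M * (1 + e^-1) * ((u y - v y) ^+ 2 * f y) + M * e * (v y ^+ 2 * f y) =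
    M * (((1 + e^-1) * (u y - v y) ^+ 2 + e * v y ^+ 2) * f y) by ring.
  rewrite normrM; apply: ler_pM => //.
    by apply: phiM; exact: dyadic_floor_unit_cube.
  rewrite normrM (ger0_norm (ltW f0)); apply: ler_wpM2r; first exact: ltW.
  exact: young_sqr_dist.
rewrite Rintegral_sum3// mul0r addr0 ratio_sqdist_avg -energyE -!mulrA -mulrDr.
by rewrite ler_wpM2l// lerD2l ler_wpM2l ?(ltW e0)// dyadic_energy_le.
Qed.

Lemma cvg_grid_energy phi (M : R) :
  (forall y, Q y -> phi (dyadic_floor j y) @[j --> \oo] --> phi y) ->
  (forall y, Q y -> `|phi y| <= M) ->
  grid_mean j (fun x => phi x * (dyadic_average j g x ^+ 2 / dyadic_average j f x))
    @[j --> \oo] --> int (fun y => phi y * (g y ^+ 2 / f y)).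
Proof.
move=> cphi phiM; set A := fun j => grid_mean j _.
pose B j := int (fun y => phi (dyadic_floor j y) * (g y ^+ 2 / f y)).
have cB : B j @[j --> \oo] --> int (fun y => phi y * (g y ^+ 2 / f y)).
  have [_] := @cvg_grid_mean _ _ phi M _ energy_int cphi phiM.
  apply: cvg_trans; apply: near_eq_cvg; apply: nearW => j.
  by rewrite /B Rintegral_dyadic_step.
rewrite (_ : A = (A \- B) \+ B); last first.
  by apply/funext => j /=; rewrite subrK.
rewrite -[X in _ --> X]add0r; apply: cvgD cB.
have M0 : 0 <= M.
  apply: le_trans (phiM 0 _); first exact: normr_ge0.
  by move=> i; rewrite !mxE lexx/=.
have E0 : 0 <= energy.
  by apply: Rintegral_ge0 => y Qy; rewrite divr_ge0 ?sqr_ge0 ?ltW ?f_gt0.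
apply/cvgrPdist_le => eta eta0.
(* [e] and then [c] make each of the two terms of [grid_energy_dist] at most
   eta / 2; the increments M + 1 and energy + 1 avoid dividing by 0. *)
pose e := eta / (2 * (M + 1) * (energy + 1)).
have e0 : 0 < e by rewrite divr_gt0// !mulr_gt0// ltr_wpDl.
pose c := eta / (2 * (M + 1) * (1 + e^-1)).
have c0 : 0 < c by rewrite divr_gt0// !mulr_gt0// ?ltr_wpDl// ?addr_gt0 ?invr_gt0.
have /cvgrPdist_le/(_ c c0) := cvg_dyadic_energy.
apply: filterS => j; rewrite ger0_norm ?subr_ge0 ?dyadic_energy_le// => jc.
rewrite sub0r normrN.
apply: (le_trans (grid_energy_dist j e0 phiM)).
have e1 : 0 < 1 + e^-1 by rewrite addr_gt0 ?invr_gt0.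
have M1 : M + 1 != 0 by rewrite gt_eqF// ltr_wpDl.
have le1 : (1 + e^-1) * (energy - dyadic_energy j f g) <= eta / (2 * (M + 1)).
  apply: (@le_trans _ _ ((1 + e^-1) * c)); first by rewrite ler_wpM2l// ltW.
  rewrite /c le_eqVlt; apply/orP; left; apply/eqP.
  by move: (1 + e^-1) e1 => E Epos; field; rewrite M1 gt_eqF.
have le2 : e * energy <= eta / (2 * (M + 1)).
  apply: (@le_trans _ _ (e * (energy + 1))).
    by rewrite ler_wpM2l ?(ltW e0)// lerDl.
  rewrite /e le_eqVlt; apply/orP; left; apply/eqP; field.
  by rewrite M1 gt_eqF// ltr_wpDl.
apply: (@le_trans _ _ (M * (eta / (2 * (M + 1)) + eta / (2 * (M + 1))))).
  by rewrite ler_wpM2l// lerD.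
apply: (@le_trans _ _ ((M + 1) * (eta / (2 * (M + 1)) + eta / (2 * (M + 1))))).
  by rewrite ler_wpM2r ?lerDl// addr_ge0// divr_ge0 ?mulr_ge0 ?addr_ge0// ltW.
rewrite le_eqVlt; apply/orP; left; apply/eqP.
by field; exact: M1.
Qed.

End dyadic_energy.

(** * The density curve and the main theorem *)

Section density_curve.
Context {R : realType} {n : nat}.
Local Notation rV := 'rV[R]_n.+1.

Lemma density_curveE (f g : rV -> R) (t : R) (x : rV) : 0 < f x ->
  density_curve f g t x =
    cos (t / 2) ^+ 2 * f x + (2 * cos (t / 2) * sin (t / 2)) * g x
    + sin (t / 2) ^+ 2 * (g x ^+ 2 / f x).
Proof.
move=> f0; rewrite /density_curve cosB; set u := g x / f x.
have u0 : 0 < 1 + u ^+ 2 by rewrite ltr_pwDl// sqr_ge0.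
have C2 : (1 + u ^+ 2) * cos (atan u) ^+ 2 = 1.
  by rewrite cos_atan exprVn sqr_sqrtr ?(ltW u0)// divff// gt_eqF.
have C0 : cos (atan u) != 0.
  by rewrite cos_atan invr_eq0 sqrtr_eq0 -ltNge.
have -> : sin (atan u) = u * cos (atan u).
  have /(congr1 (fun z => z * cos (atan u))) := atanK u.
  by rewrite /tan divfK.
have -> : (f x ^+ 2 + g x ^+ 2) / f x = f x * (1 + u ^+ 2).
  by rewrite /u; field; rewrite gt_eqF.
have -> : f x * (1 + u ^+ 2) * (cos (t / 2) * cos (atan u) +
    sin (t / 2) * (u * cos (atan u))) ^+ 2 =
  f x * ((1 + u ^+ 2) * cos (atan u) ^+ 2) * (cos (t / 2) + u * sin (t / 2)) ^+ 2.
  by ring.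
by rewrite C2 /u; field; rewrite gt_eqF.
Qed.

End density_curve.

Section dyadic_average_pos.
Context {R : realType} {n : nat}.
Local Notation rV := 'rV[R]_n.+1.
Local Notation lrV := (caratheodory_type (@lebesgue_outer R n)).
Local Notation mu := (@lebesgue_rV R n).
Local Notation Q := (@unit_cube R n).

(** The averages are positive because [f] is bounded below on a cube, which has
    positive measure. *)
Lemma dyadic_average_gt0 (f : rV -> R) (delta : R) j k :
  (forall y, Q y -> 0 < f y) -> mu.-integrable Q (EFin \o f) -> 0 < delta ->
  {ae mu, forall y, Q y -> delta <= f y} ->
  0 < dyadic_average j f (@dyadic_point R n j k).
Proof.
move=> f0 f_int d0 df; set C := dyadic_cube j (@dyadic_point R n j k).
have mC : measurable (C : set lrV) by exact: measurable_dyadic_cube.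
have CQ : C `<=` Q by move=> y Cy; rewrite (unit_cube_dyadic j); exists k.
have f_intC : mu.-integrable C (EFin \o f).
  exact: integrableS measurable_unit_cube mC CQ f_int.
have V0 : 0 < 2^-1 ^+ (n.+1 * j) :> R by rewrite exprn_gt0// invr_gt0.
rewrite /dyadic_average -/C lebesgue_dyadic_cube /=.
rewrite mulr_gt0 ?invr_gt0//.
apply: (@lt_le_trans _ _ (delta * 2^-1 ^+ (n.+1 * j))); first exact: mulr_gt0.
rewrite -lee_fin /Rintegral fineK; last exact: integrable_fin_num.
rewrite EFinM -(lebesgue_dyadic_cube j (@dyadic_point R n j k)) -integral_cst//.
apply: ae_ge0_le_integral => //.
- by move=> y _; rewrite lee_fin ltW.
- by move=> y Cy; rewrite lee_fin ltW// f0//; exact: CQ.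
- exact: measurable_int f_intC.
- have [N [mN N0 fN]] := df; exists N; split => // y nCy; apply: fN => Qy.
  by apply: nCy => /CQ/Qy; rewrite lee_fin.
Qed.

End dyadic_average_pos.

Theorem theorem5p1 (R : realType) (n : nat) (f0 g0 : 'rV[R]_n.+1 -> R)
  (delta : R) :
  measurable_fun (unit_cube : set (caratheodory_type lebesgue_outer)) f0 ->
  (forall x, unit_cube x -> 0 < f0 x) ->
  (\int[lebesgue_rV]_(x in unit_cube) (f0 x)%:E = 1)%E ->
  0 < delta ->
  {ae lebesgue_rV, forall x, unit_cube x -> delta <= f0 x} ->
  lebesgue_rV.-integrable unit_cube (EFin \o g0) ->
  (\int[lebesgue_rV]_(x in unit_cube) (g0 x)%:E = 0)%E ->
  (\int[lebesgue_rV]_(x in unit_cube) (g0 x ^+ 2 / f0 x)%:E = 1)%E ->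
  [/\ \forall j \near \oo, 0 < dyadic_energy j f0 g0,
      forall j, 0 < dyadic_energy j f0 g0 ->
        let fj := dyadic_average j f0 in
        let gj := dyadic_normalized j f0 g0 in
        [/\ (\int[dyadic_measure j]_(x in dyadic_grid j) (fj x)%:E = 1)%E,
            (\int[dyadic_measure j]_(x in dyadic_grid j) (gj x)%:E = 0)%E &
            (\int[dyadic_measure j]_(x in dyadic_grid j)
               (gj x ^+ 2 / fj x)%:E = 1)%E] &
      forall (t : R) (phi : 'rV[R]_n.+1 -> R),
        {within unit_cube, continuous phi} ->
        compactly_supported_in_cube phi ->
        (fun j => `| \int[dyadic_measure j]_(y in dyadic_grid j)
                       (density_curve (dyadic_average j f0)
                          (dyadic_normalized j f0 g0) t y * phi y)%:E
                   - \int[lebesgue_rV]_(y in unit_cube)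
                       (density_curve f0 g0 t y * phi y)%:E |)%E
          @ \oo --> 0%E].
Proof.
move=> mf f_gt0 If delta0 f_delta g_int Ig Igf.
pose Q : set (caratheodory_type (@lebesgue_outer R n)) := unit_cube.
have mQ : measurable Q by exact: measurable_unit_cube.
have mg : measurable_fun Q g0 by apply/measurable_EFinP; exact: measurable_int g_int.
have f_ge0 y : Q y -> 0 <= f0 y by move=> Qy; rewrite ltW// f_gt0.
have f_int : lebesgue_rV.-integrable Q (EFin \o f0).
  by apply: (integrableR_ge0 mf f_ge0); rewrite If ltry.
have e_int : lebesgue_rV.-integrable Q (EFin \o (fun y => g0 y ^+ 2 / f0 y)).
  apply: integrableR_ge0.
  - by apply: measurable_fun_div f_ge0; first exact: measurable_funX.
  - by move=> y Qy; rewrite divr_ge0 ?sqr_ge0// f_ge0.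
  - by rewrite Igf ltry.
have f_avg_gt0 j k :=
  @dyadic_average_gt0 R n f0 delta j k f_gt0 f_int delta0 f_delta.
have I_energy : \int[lebesgue_rV]_(y in Q) (g0 y ^+ 2 / f0 y) = 1 :> R.
  by rewrite /Rintegral Igf.
have := cvg_dyadic_energy f_gt0 f_int g_int e_int f_avg_gt0.
rewrite I_energy => cE.
have mean_avg j F : lebesgue_rV.-integrable Q (EFin \o F) ->
    grid_mean j (dyadic_average j F) = \int[lebesgue_rV]_(y in Q) F y.
  move=> iF; transitivity (\int[lebesgue_rV]_(y in Q) (1 * F y)); last first.
    by congr Rintegral; apply/funext => y; rewrite mul1r.
  rewrite (Rintegral_dyadic_step j (fun=> 1))//.
  by apply: eq_grid_mean => k; rewrite mul1r.
split.
- have /cvgrPdist_lt/(_ 1 ltr01) := cE.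
  by apply: filterS => j; rewrite ltr_norml => /andP[_]; lra.
- move=> j Ej fj gj; rewrite !integral_dyadic_grid; split; congr EFin.
  + by rewrite mean_avg// /Rintegral If.
  + by rewrite grid_meanZ mean_avg// /Rintegral Ig mulr0.
  + rewrite (_ : grid_mean _ _ = (dyadic_energy j f0 g0)^-1 * dyadic_energy j f0 g0).
      by rewrite mulVf// gt_eqF.
    rewrite [in X in _ = _ * X]dyadic_energyE -grid_meanZ.
    apply: eq_grid_mean => k.
    by rewrite /gj /dyadic_normalized exprMn exprVn sqr_sqrtr ?(ltW Ej)// mulrA.
move=> t phi cphi sphi.
have [M M0 phiM] := compactly_supported_bounded cphi sphi.
have cphij := cvg_within_dyadic_floor cphi.
pose c := cos (t / 2) : R; pose s := sin (t / 2) : R.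
(* [r j] is the normalization of g^j; it enters once in the term linear in g
   and twice in the quadratic one. *)
pose r j := (Num.sqrt (dyadic_energy j f0 g0))^-1.
have [pf_int cf] := @cvg_grid_mean _ _ phi M _ f_int cphij phiM.
have [pg_int cg] := @cvg_grid_mean _ _ phi M _ g_int cphij phiM.
have [pe_int _] := @cvg_grid_mean _ _ phi M _ e_int cphij phiM.
have ce := cvg_grid_energy f_gt0 f_int g_int e_int f_avg_gt0 cphij phiM.
set A := fun j => grid_mean j _ in cf; set B := fun j => grid_mean j _ in cg.
set C := fun j => grid_mean j _ in ce.
have cr : r j @[j --> \oo] --> (1 : R).
  rewrite /r -[X in _ --> X]invr1 -[in X in _ --> X]sqrtr1.
  apply: cvgV; first by rewrite sqrtr1 oner_neq0.
  by apply: cvg_comp cE _; exact: sqrt_continuous.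
pose I := c ^+ 2 * \int[lebesgue_rV]_(y in Q) (phi y * f0 y)
  + (2 * c * s) * \int[lebesgue_rV]_(y in Q) (phi y * g0 y)
  + s ^+ 2 * \int[lebesgue_rV]_(y in Q) (phi y * (g0 y ^+ 2 / f0 y)) : R.
pose S j := c ^+ 2 * A j + (2 * c * s) * (r j * B j) + s ^+ 2 * (r j * r j * C j).
have cS : S j @[j --> \oo] --> I.
  rewrite /I -[X in _ + (_ * X) + _]mul1r -[X in _ + _ * X]mul1r.
  rewrite -[X in _ + _ * (X * _)]mulr1.
  apply: cvgD; first apply: cvgD.
  - by apply: cvgM => //; exact: cvg_cst.
  - by apply: cvgM; [exact: cvg_cst|exact: cvgM].
  - by apply: cvgM; [exact: cvg_cst|apply: cvgM => //; exact: cvgM].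
have IE : (\int[lebesgue_rV]_(y in Q) (density_curve f0 g0 t y * phi y)%:E = I%:E)%E.
  pose F (y : caratheodory_type (@lebesgue_outer R n)) :=
    c ^+ 2 * (phi y * f0 y) + (2 * c * s) * (phi y * g0 y)
    + s ^+ 2 * (phi y * (g0 y ^+ 2 / f0 y)).
  have F_int : lebesgue_rV.-integrable Q (EFin \o F) by exact: integrableR_sum3.
  rewrite (@eq_integral _ _ _ _ _ (EFin \o F)).
    by rewrite -[LHS]fineK ?integrable_fin_num//; congr EFin; exact: Rintegral_sum3.
  move=> y; rewrite inE => Qy; congr EFin.
  by rewrite density_curveE ?f_gt0// /F /c /s; ring.
have SE j : (\int[dyadic_measure j]_(y in dyadic_grid j)
    (density_curve (dyadic_average j f0) (dyadic_normalized j f0 g0) t y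
     * phi y)%:E = (S j)%:E)%E.
  rewrite integral_dyadic_grid; congr EFin.
  rewrite /S /A /B /C -!grid_meanZ -!grid_meanD; apply: eq_grid_mean => k.
  by rewrite density_curveE// /dyadic_normalized -/(r j) /c /s; ring.
have -> : (fun j => `| \int[dyadic_measure j]_(y in dyadic_grid j)
      (density_curve (dyadic_average j f0)
         (dyadic_normalized j f0 g0) t y * phi y)%:E
    - \int[lebesgue_rV]_(y in unit_cube) (density_curve f0 g0 t y * phi y)%:E |)%E
    = (fun j => (`|S j - I|)%:E).
  by apply/funext => j; rewrite SE IE.
apply: cvg_EFin; first exact: nearW.
rewrite -[X in _ --> X](normr0 R) -(subrr I).
by apply: cvg_norm; apply: cvgB => //; exact: cvg_cst.
Qed.
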